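(* Let $(X,G,m)$ be a dynamical system and let $d$ be a metric on $X$ inducing the topology of $X$. Then the following assertions are equivalent: (i) For any $\varepsilon>0$ the set of measure theoretic $\varepsilon$-almost periods of $d$ is relatively dense in $G$. (ii) The dynamical system $(X,G,m)$ has discrete spectrum.
   Context: Dynamical system: $X$ is a compact space whose topology is induced by a metric, $G$ is a locally compact, $\sigma$-compact, abelian group (written additively) acting continuously on $X$ via $G\times X\to X$, $(t,x)\mapsto tx$, and $m$ is a $G$-invariant (Borel) probability measure on $X$. For $t\in G$ the unitary operator $T_t$ on $L^2(X,m)$ is given by $T_tf=f(t\,\cdot)$. Measure theoretic almost periods: for a continuous pseudometric $e$ on $X$ (in particular for $e=d$) and $\varepsilon>0$, an element $t\in G$ is a measure theoretic $\varepsilon$-almost period of $e$ if $m(\{x\in X:e(x,tx)>\varepsilon\})<\varepsilon$. A subset $\mathcal{T}\subset G$ is relatively dense if there is a compact $K\subset G$ with $\mathcal{T}+K=G$. Discrete spectrum: $\widehat{G}$ is the group of continuous group homomorphisms $\gamma:G\to\{z\in\mathbb{C}:|z|=1\}$. A function $f\in L^2(X,m)$, $f\ne0$, is an eigenfunction to the eigenvalue $\gamma\in\widehat{G}$ if $T_tf=\gamma(t)f$ for every $t\in G$. The system has discrete spectrum if $L^2(X,m)$ has an orthonormal basis consisting of eigenfunctions. *)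

(* Defs.v *)
From HB Require Import structures.
From mathcomp Require Import all_boot all_order all_algebra.
From mathcomp Require Import all_classical all_reals all_analysis.
From mathcomp Require Import complex.

Set Implicit Arguments.
Unset Strict Implicit.
Unset Printing Implicit Defensive.

Import Order.TTheory GRing.Theory Num.Theory.
Import numFieldNormedType.Exports.

Local Open Scope classical_set_scope.
Local Open Scope ring_scope.
Local Open Scope complex_scope.

(* Measurable types of the library are pointed. On a space that carries a
   probability measure this is no restriction. *)
#[short(type="pmetricType")]
HB.structure Definition PointedMetric (K : numDomainType) :=
  {M of Metric K M & Pointed M}.

Notation borel X := (g_sigma_algebraType (@open X)).

Section ComplexL2.
Context d (T : measurableType d) (R : realType).
Variable mu : {measure set T -> \bar R}.
Implicit Types f g : T -> R[i].

(* Elements of L^2(T, mu; C) are represented by functions, so that equality in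
   L^2 is equality mu-almost everywhere. *)
Definition L2norm f : \bar R :=
  ('N[mu]_2%:E[EFin \o (@ComplexField.Normc.normc R \o f)])%E.

Definition in_L2 f : Prop :=
  [/\ measurable_fun [set: T] (fun x => complex.Re (f x)),
      measurable_fun [set: T] (fun x => complex.Im (f x)) &
      (L2norm f < +oo)%E].

Definition cintegral f : R[i] :=
  (\int[mu]_x complex.Re (f x)) +i* (\int[mu]_x complex.Im (f x)).

Definition inner f g : R[i] := cintegral (fun x => f x * conjc (g x)).

(* Two representatives of the same class cannot both belong to [B]: they would
   have inner product 1. *)
Definition orthonormal_basis (B : set (T -> R[i])) : Prop :=
  [/\ forall f, B f -> in_L2 f,
      forall f, B f -> inner f f = 1,
      forall f g, B f -> B g -> f <> g -> inner f g = 0 &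
      forall f, in_L2 f -> forall eps : R, 0 < eps ->
        exists n (b : 'I_n -> T -> R[i]) (c : 'I_n -> R[i]),
          (forall i, B (b i)) /\
          (L2norm (fun x => f x - \sum_(i < n) c i * b i x)%R < eps%:E)%E].

End ComplexL2.

Section TopologicalGroup.
Variable G : topologicalZmodType.

Definition sigma_compact (Y : topologicalType) : Prop :=
  exists K : nat -> set Y,
    (forall n, compact (K n)) /\ \bigcup_n K n = [set: Y].

Definition relatively_dense (A : set G) : Prop :=
  exists2 K : set G, compact K & [set a + k | a in A & k in K] = [set: G].

Definition dual_group (R : realType) : set (G -> R[i]) :=
  [set gamma | [/\ continuous (gamma : G -> R[i]^o),
      forall s t, gamma (s + t) = gamma s * gamma t &
      forall t, `|gamma t| = 1]].

Definition continuous_action (X : topologicalType) (act : G -> X -> X) : Prop :=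
  [/\ forall x, act 0 x = x,
      forall s t x, act (s + t) x = act s (act t x) &
      continuous (fun p : G * X => act p.1 p.2)].

End TopologicalGroup.
Arguments dual_group : clear implicits.

Section DynamicalSystem.
Context (R : realType) (G : topologicalZmodType) (X : ptopologicalType).
Variables (act : G -> X -> X) (m : probability (borel X) R).

Definition invariant_measure : Prop :=
  forall t (A : set (borel X)), measurable A -> m (act t @^-1` A) = m A.

Definition almost_period (e : X -> X -> R) (eps : R) : set G :=
  [set t | (m [set x | (eps < e x (act t x))%R] < eps%:E)%E].

Definition koopman (t : G) (f : X -> R[i]) : X -> R[i] := fun x => f (act t x).

Definition eigenfunction (gamma : G -> R[i]) (f : X -> R[i]) : Prop :=
  [/\ in_L2 m f,
      ~ {ae m, forall x, f x = 0} &
      forall t, {ae m, forall x, koopman t f x = gamma t * f x}].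

Definition discrete_spectrum : Prop :=
  exists2 B : set (X -> R[i]), orthonormal_basis m B &
    forall f, B f -> exists2 gamma, dual_group G R gamma & eigenfunction gamma f.

End DynamicalSystem.

(* Main.v *)
Require Import Defs.
From HB Require Import structures.
From mathcomp Require Import all_boot all_order all_algebra.
From mathcomp Require Import all_classical all_reals all_analysis.
From mathcomp Require Import measurable_realfun complex ring lra.

(** Both conditions are compared with a third one: every vector of L2 has a
    totally bounded orbit under the Koopman operators.

    Suppose first that almost periods of the distance are relatively dense. A
    Lipschitz function [u] changes little in the mean square under an almost
    period ([almost_period_return]), and small elements of the group are almost
    periods ([near_almost_period]), so finitely many translates of a small
    neighbourhood cover the orbit of [u] ([regular_orbit_of_returns]). The
    vectors with this property form a closed subspace; it contains the
    indicators of open sets, hence by a monotone class argument all indicators,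
    hence all of L2 ([regular_L2]).

    Totally bounded orbits produce eigenvectors ([eigenvector_from_orbit]). An
    abelian group carries an invariant mean, and averaging the rank one
    operators of the orbit of a nonzero [f] gives an invariant quadratic form
    [x |-> M_s |<x, U s f>|^2], which is nonzero at [f] and compact because the
    orbit is totally bounded. A compact form attains its maximum on the unit
    ball ([compact_form_maximum]); the maximisers form an invariant subspace of
    finite dimension, in which commuting operators have a common eigenvector
    ([representation_common_eigenvector]), and they are orthogonal to
    everything that is orthogonal to the orbit. A maximal orthonormal system of
    eigenvectors therefore spans a dense subspace: otherwise the orthogonal
    component of some vector would yield one more eigenvector
    ([eigenvector_basis]). The eigenvalues are continuous characters because
    the orbits are continuous ([eigenvector_eigenfunction]).

    Conversely, the orbit of an eigenfunction lies on a circle, so with a basis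
    of eigenfunctions all orbits are totally bounded. Finitely many vectors
    then return simultaneously close to themselves along a set of elements of
    which finitely many translates cover the group. Applied to the distances to
    the points of a fine net of [X], this gives almost periods of the distance
    ([almost_periods_of_totally_bounded]).

    Vectors of L2 are functions, so the inner product is only semidefinite, and
    the general theory is set up for such products. It works with the square
    of the seminorm, for which [|x + y|^2 <= 2 |x|^2 + 2 |y|^2] replaces the
    triangle inequality. *)

Set Implicit Arguments.
Unset Strict Implicit.
Unset Printing Implicit Defensive.

Import Order.TTheory GRing.Theory Num.Theory.
Import numFieldNormedType.Exports.

Local Open Scope classical_set_scope.
Local Open Scope ring_scope.
Local Open Scope complex_scope.

(** * Semi-inner product spaces *)

Lemma le0_of_small (R : realType) (x : R) :
  (forall a : R, 0 < a -> x <= a) -> x <= 0.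
Proof. by move=> h; apply/ler_addgt0Pl => a /h; rewrite addr0. Qed.

Section SemiInnerProduct.
Context (R : realType) (V : lmodType R[i]) (ip : V -> V -> R[i]).

Record semi_inner_product : Prop := SemiInnerProduct {
  ipDl : forall x y z, ip (x + y) z = ip x z + ip y z;
  ipZl : forall a x z, ip (a *: x) z = a * ip x z;
  ipC : forall x y, ip y x = conjc (ip x y);
  ip_ge0 : forall x, 0 <= complex.Re (ip x x) }.

Definition normc2 (z : R[i]) : R := complex.Re z ^+ 2 + complex.Im z ^+ 2.

Lemma normc2_ge0 z : 0 <= normc2 z.
Proof. by rewrite addr_ge0 ?sqr_ge0. Qed.

Lemma normc2_eq0 z : normc2 z = 0 -> z = 0.
Proof.
case: z => a b; rewrite /normc2 /= => /eqP.
by rewrite paddr_eq0 ?sqr_ge0// !sqrf_eq0 => /andP[/eqP -> /eqP ->].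
Qed.

Lemma normc2M (a b : R[i]) : normc2 (a * b) = normc2 a * normc2 b.
Proof. by case: a b => [a a'] [b b']; rewrite /normc2 /=; ring. Qed.

Lemma normc2D (a b : R[i]) : normc2 (a + b) <= 2 * normc2 a + 2 * normc2 b.
Proof.
case: a b => [a a'] [b b']; rewrite /normc2 /=.
have : 0 <= (a - b) ^+ 2 + (a' - b') ^+ 2 by rewrite addr_ge0 ?sqr_ge0.
lra.
Qed.

Definition sqnorm x : R := complex.Re (ip x x).

Hypothesis ipP : semi_inner_product.

Lemma ip0l y : ip 0 y = 0.
Proof. by rewrite -(scale0r (0 : V)) (ipZl ipP) mul0r. Qed.

Lemma ipNl x y : ip (- x) y = - ip x y.
Proof. by rewrite -scaleN1r (ipZl ipP) mulN1r. Qed.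

Lemma ipBl x y z : ip (x - y) z = ip x z - ip y z.
Proof. by rewrite (ipDl ipP) ipNl. Qed.

Lemma ipDr x y z : ip x (y + z) = ip x y + ip x z.
Proof. by rewrite !(ipC ipP _ x) (ipDl ipP) rmorphD. Qed.

Lemma ipZr a x y : ip x (a *: y) = conjc a * ip x y.
Proof. by rewrite !(ipC ipP _ x) (ipZl ipP) rmorphM. Qed.

Lemma ipNr x y : ip x (- y) = - ip x y.
Proof. by rewrite !(ipC ipP _ x) ipNl rmorphN. Qed.

Lemma ipBr x y z : ip x (y - z) = ip x y - ip x z.
Proof. by rewrite ipDr ipNr. Qed.

Lemma ip_sqnorm x : ip x x = (sqnorm x)%:C.
Proof.
have := ipC ipP x x; rewrite /sqnorm; case: (ip x x) => a b /= [/eqP].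
by rewrite -subr_eq0 opprK -mulr2n mulrn_eq0 /= => /eqP ->.
Qed.

Lemma sqnorm_ge0 x : 0 <= sqnorm x. Proof. exact: (ip_ge0 ipP). Qed.

Lemma sqnorm0 : sqnorm 0 = 0. Proof. by rewrite /sqnorm ip0l. Qed.

Lemma sqnormZ a x : sqnorm (a *: x) = normc2 a * sqnorm x.
Proof.
rewrite /sqnorm (ipZl ipP) ipZr ip_sqnorm.
by case: a => a b; rewrite /normc2 /=; ring.
Qed.

Lemma sqnormN x : sqnorm (- x) = sqnorm x.
Proof. by rewrite -scaleN1r sqnormZ /normc2 /= oppr0; ring. Qed.

Lemma sqnormBC x y : sqnorm (x - y) = sqnorm (y - x).
Proof. by rewrite -sqnormN opprB. Qed.

Lemma sqnormDE x y :
  sqnorm (x + y) = sqnorm x + sqnorm y + 2 * complex.Re (ip x y).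
Proof.
rewrite /sqnorm (ipDl ipP) !ipDr (ipC ipP x y) /= .
by case: (ip x x) (ip y y) (ip x y) => [a a'] [b b'] [c c'] /=; ring.
Qed.

Lemma parallelogram x y :
  sqnorm (x + y) + sqnorm (x - y) = 2 * sqnorm x + 2 * sqnorm y.
Proof.
rewrite !sqnormDE sqnormN ipNr.
by case: (ip x y) => a b /=; ring.
Qed.

Lemma sqnormD x y : sqnorm (x + y) <= 2 * sqnorm x + 2 * sqnorm y.
Proof. by rewrite -parallelogram lerDl sqnorm_ge0. Qed.

Lemma sqnormB x y z : sqnorm (x - y) <= 2 * sqnorm (x - z) + 2 * sqnorm (z - y).
Proof. by rewrite (le_trans _ (sqnormD _ _))// addrA subrK. Qed.

(** Testing the hypothesis on [c = - s <x, y>] for real [s] and optimising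
    over [s] gives the estimate. It covers the Cauchy-Schwarz inequality
    ([d = |x|^2]), the orthogonality of minimisers ([d = 0]), and the almost
    orthogonality of almost minimisers. *)
Lemma almost_minimal_orthogonal x y d :
  (forall c, sqnorm x - d <= sqnorm (x + c *: y)) ->
  normc2 (ip x y) <= d * sqnorm y.
Proof.
move=> h; set n := normc2 _.
have n0 : 0 <= n by exact: normc2_ge0.
have hs (s : R) : 0 <= d + s ^+ 2 * n * sqnorm y - 2 * s * n.
  have := h (- (s%:C * ip x y)); rewrite sqnormDE sqnormZ ipZr.
  rewrite -subr_ge0; congr (_ <= _); rewrite /n /normc2.
  by case: (ip x y) => a b /=; ring.
have := sqnorm_ge0 y; rewrite le_eqVlt => /predU1P[y0|y0].
  rewrite -y0 mulr0; have := hs ((d + 1) / n); rewrite -y0 mulr0 addr0.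
  move: n0; rewrite le_eqVlt => /predU1P[<-//|n0].
  have /= := hs 0; have -> : 2 * ((d + 1) / n) * n = 2 * (d + 1).
    by field; rewrite gt_eqF.
  lra.
have := hs (sqnorm y)^-1.
have -> : d + (sqnorm y)^-1 ^+ 2 * n * sqnorm y - 2 * (sqnorm y)^-1 * n
   = d - n / sqnorm y by field; rewrite gt_eqF.
by rewrite subr_ge0 ler_pdivrMr.
Qed.

Lemma cauchy_schwarz x y : normc2 (ip x y) <= sqnorm x * sqnorm y.
Proof.
by apply: almost_minimal_orthogonal => c; rewrite subrr sqnorm_ge0.
Qed.

Lemma ip_null x y : sqnorm y = 0 -> ip x y = 0.
Proof.
move=> y0; apply: normc2_eq0; apply/eqP; rewrite eq_le normc2_ge0 andbT.
by rewrite (le_trans (cauchy_schwarz x y))// y0 mulr0.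
Qed.

Lemma sqnormD_null x y : sqnorm y = 0 -> sqnorm (x + y) = sqnorm x.
Proof. by move=> y0; rewrite sqnormDE y0 ip_null //= mulr0 !addr0. Qed.

(** Limits are unique only up to vectors of norm zero. *)
Definition complete_sqnorm : Prop := forall u : nat -> V,
  (forall e : R, 0 < e -> exists n, forall i j, (n <= i)%N -> (n <= j)%N ->
     sqnorm (u i - u j) < e) ->
  exists x, forall e : R, 0 < e -> exists n, forall i, (n <= i)%N ->
     sqnorm (u i - x) < e.

(** Nested sets rather than sequences: below, the sets consist of almost
    minimisers or almost maximisers. *)
Lemma cantor_intersection (C : nat -> set V) : complete_sqnorm ->
  (forall n, C n !=set0) -> (forall m n, (m <= n)%N -> C n `<=` C m) ->
  (forall e : R, 0 < e -> exists n, forall x y, C n x -> C n y -> sqnorm (x - y) < e) ->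
  exists x, forall n (e : R), 0 < e -> exists2 y, C n y & sqnorm (y - x) < e.
Proof.
move=> cV C0 dC diamC.
have [u Cu] : {u : nat -> V & forall n, C n (u n)}.
  by exists (fun n => sval (cid (C0 n))) => n; case: cid.
have [|x ux] := cV u.
  move=> e /diamC[n Cn]; exists n => i j ni nj.
  by apply: Cn; [exact: dC (Cu i)|exact: dC (Cu j)].
exists x => n e /ux[k kx]; exists (u (maxn n k)).
  by apply: dC (Cu _); exact: leq_maxl.
by apply: kx; exact: leq_maxr.
Qed.

(** The minimal distance from [f] to a subspace is approached along a
    Cauchy sequence, whose limit is the component of [f] orthogonal to it. *)
Lemma orthogonal_component (S : set V) (f : V) (e : R) : complete_sqnorm ->
  S 0 -> (forall x y, S x -> S y -> S (x + y)) ->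
  (forall a x, S x -> S (a *: x)) ->
  0 < e -> (forall s, S s -> e <= sqnorm (f - s)) ->
  exists2 h, 0 < sqnorm h & forall s, S s -> ip h s = 0.
Proof.
move=> cV S0 SD SZ e0 hf.
pose D := inf [set sqnorm (f - s) | s in S].
have lbD s : S s -> D <= sqnorm (f - s).
  move=> Ss; apply: ge_inf; last by exists s.
  by exists 0 => _ [t _ <-]; exact: sqnorm_ge0.
pose C n := [set x | sqnorm x < D + n.+1%:R^-1 /\ exists2 s, S s & x = f - s].
have [h Ch] : exists h, forall n (a : R), 0 < a -> exists2 y, C n y & sqnorm (y - h) < a.
  apply: cantor_intersection => //.
  - move=> n; have /inf_adherent -/(_ n.+1%:R^-1)[] // : has_inf [set sqnorm (f - s) | s in S].
      split; first by exists (sqnorm (f - 0)); exists 0.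
      by exists 0 => _ [t _ <-]; exact: sqnorm_ge0.
    by move=> _ [s Ss <-] sD; exists (f - s); split => //; exists s.
  - move=> m n mn x [xn Sx]; split => //; rewrite (lt_le_trans xn)// lerD2l.
    by rewrite lef_pV2 ?posrE// ler_nat.
  - move=> a a0; exists (Num.truncn (4 / a)) => x y [xD [s Ss xE]] [yD [t St yE]].
    have := parallelogram x y.
    (* the midpoint of [x] and [y] again has the form [f - s] *)
    have -> : x + y = 2 *: (f - 2^-1 *: (s + t)).
      rewrite xE yE scalerBr scalerA divff ?scale1r; last by rewrite pnatr_eq0.
      by rewrite scaler_nat mulr2n opprD addrACA.
    rewrite sqnormZ; have -> : normc2 2 = 4 :> R.
      by rewrite /normc2 /= addr0 expr0n /= addr0; ring.
    have := lbD _ (SZ 2^-1 _ (SD _ _ Ss St)).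
    have : (Num.truncn (4 / a)).+1%:R^-1 < a / 4.
      by rewrite -[ltRHS]invf_div ltf_pV2 ?posrE ?divr_gt0// truncnS_gt.
    move: xD yD; set k := _^-1; set A := sqnorm (_ - _ *: _).
    move: (sqnorm _) (sqnorm _) (sqnorm _) => X Y Z; lra.
exists h.
  have [y [_ [s Ss yE]] yh] := Ch 0%N (e / 4) (divr_gt0 e0 (ltr0n _ 4)).
  have := sqnormD h (y - h); rewrite addrC subrK; have := hf _ Ss; rewrite -yE.
  lra.
move=> b Sb; apply: normc2_eq0; apply/eqP; rewrite eq_le normc2_ge0 andbT.
apply: le0_of_small => a a0.
have b0 := sqnorm_ge0 b.
pose n := Num.truncn (4 * (sqnorm b + 1) / a).
have na : sqnorm b / n.+1%:R <= a / 4.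
  rewrite ler_pdivrMr ?ltr0n//.
  have : 4 * (sqnorm b + 1) / a < n.+1%:R by rewrite truncnS_gt.
  rewrite ltr_pdivrMr//; lra.
have q0 : 0 < a / (4 * (sqnorm b + 1)) by rewrite divr_gt0// mulr_gt0//; lra.
have [y [yD [s Ss yE]] yh] := Ch n _ q0.
have hy : normc2 (ip y b) <= n.+1%:R^-1 * sqnorm b.
  apply: almost_minimal_orthogonal => c.
  apply: (@le_trans _ _ D); first by rewrite lerBlDr ltW.
  have -> : y + c *: b = f - (s + (- c) *: b).
    by rewrite yE opprD scaleNr opprK addrA.
  by apply: lbD; apply: SD => //; exact: SZ.
have := normc2D (ip (h - y) b) (ip y b); rewrite -(ipDl ipP) subrK.
have := cauchy_schwarz (h - y) b; rewrite sqnormBC.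
have : sqnorm (y - h) * sqnorm b <= a / 4.
  rewrite (@le_trans _ _ (a / (4 * (sqnorm b + 1)) * (sqnorm b + 1)))//.
    by apply: ler_pM => //; [exact: sqnorm_ge0|exact: ltW|lra].
  by have -> : a / (4 * (sqnorm b + 1)) * (sqnorm b + 1) = a / 4 by field; lra.
rewrite [_^-1 * _]mulrC in hy; have := le_trans hy na.
clear; lra.
Qed.

End SemiInnerProduct.

(** * Invariant means on abelian groups *)

Section InvariantMean.
Context (R : realType).

(** A cluster point in a compact interval is the limit, since one of a set
    and its complement belongs to the ultrafilter. *)
Lemma ultra_cvg (T : Type) (U : set_system T) (f : T -> R) (C : R) :
  UltraFilter U -> (\forall x \near U, `|f x| <= C) -> cvg (f x @[x --> U]).
Proof.
move=> UU fC.
have [p [_ clp]] : [set` `[- C, C]] `&` cluster (f x @[x --> U]) !=set0.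
  apply: (@segment_compact R (- C) C) => //.
  by apply: filterS fC => x; rewrite ler_norml /= in_itv.
apply/cvg_ex; exists p => A nA.
have [//|nfA] := in_ultra_setVsetC (f @^-1` A) UU.
by have [y [? ?]] := clp (~` A) A nfA nA.
Qed.

Context (G : zmodType).
Implicit Types (L : seq G) (phi : G -> R).

Definition bounded_real phi := exists C : R, forall t, `|phi t| <= C.

Record invariant_mean (M : (G -> R) -> R) : Prop := InvariantMean {
  meanD : forall phi psi, bounded_real phi -> bounded_real psi ->
    M (fun t => phi t + psi t) = M phi + M psi;
  meanZ : forall a phi, bounded_real phi -> M (fun t => a * phi t) = a * M phi;
  mean_le : forall phi psi, bounded_real phi -> bounded_real psi ->
    (forall t, phi t <= psi t) -> M phi <= M psi;
  mean_cst : forall a, M (fun=> a) = a;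
  mean_shift : forall phi s, bounded_real phi ->
    M (fun t => phi (t + s)) = M phi }.

Let avg L phi : R := (\sum_(t <- L) phi t) / (size L)%:R.

Let sumset L L' := [seq a + b | a <- L, b <- L'].

Let sum_sumset L L' phi :
  \sum_(t <- sumset L L') phi t = \sum_(a <- L) \sum_(b <- L') phi (a + b).
Proof. by rewrite big_allpairs_dep. Qed.

Let avg_sumsetCA L1 L2 L :
  avg (sumset L1 (sumset L2 L)) = avg (sumset L2 (sumset L1 L)).
Proof.
apply/funext => phi; rewrite /avg; congr (_ / _); last first.
  by rewrite !size_allpairs mulnCA.
rewrite !sum_sumset.
under eq_bigr => a _ do rewrite sum_sumset.
rewrite exchange_big /=; apply: eq_bigr => b _.
rewrite sum_sumset; apply: eq_bigr => a _; apply: eq_bigr => c _.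
by rewrite addrCA.
Qed.

Let sumset_neq0 L L' : L != [::] -> L' != [::] -> sumset L L' != [::].
Proof. by rewrite -!size_eq0 size_allpairs muln_eq0 negb_or => -> ->. Qed.

(** The sets of averages over [L + L'], directed by enlarging [L]. They live
    on functionals rather than on lists, so that lists that differ by a
    permutation are identified. *)
Let avg_filter : set_system ((G -> R) -> R) :=
  [set S | exists2 L, L != [::] &
    forall L', L' != [::] -> S (avg (sumset L L'))].

Let avg_filter_proper : ProperFilter avg_filter.
Proof.
split; first by move=> [L L0 /(_ L L0)].
split.
- by exists [:: 0].
- move=> S1 S2 [L1 L10 h1] [L2 L20 h2]; exists (sumset L1 L2).
    exact: sumset_neq0.
  move=> L' L'0.
  have -> : avg (sumset (sumset L1 L2) L') = avg (sumset L1 (sumset L2 L')).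
    apply/funext => phi; rewrite /avg !size_allpairs mulnA; congr (_ / _).
    rewrite !sum_sumset; apply: eq_bigr => a _; rewrite sum_sumset.
    by apply: eq_bigr => b _; apply: eq_bigr => c _; rewrite addrA.
  split; first by apply: h1; exact: sumset_neq0.
  by rewrite avg_sumsetCA; apply: h2; exact: sumset_neq0.
- by move=> S1 S2 S12 [L L0 h]; exists L => // L' /h/S12.
Qed.

Let avg_le L phi psi : (forall t, phi t <= psi t) -> avg L phi <= avg L psi.
Proof.
by move=> h; rewrite /avg ler_wpM2r ?invr_ge0 ?ler0n// ler_sum.
Qed.

Let avg_cst L a : L != [::] -> avg L (fun=> a) = a.
Proof.
rewrite -size_eq0 => L0; rewrite /avg big_const_seq count_predT iter_addr_0.
by rewrite -[a *+ _]mulr_natr mulfK// pnatr_eq0.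
Qed.

Let avgN L phi : avg L (fun t => - phi t) = - avg L phi.
Proof. by rewrite /avg sumrN mulNr. Qed.

Let avg_norm L phi (C : R) : L != [::] -> (forall t, `|phi t| <= C) -> `|avg L phi| <= C.
Proof.
move=> L0 h; rewrite ler_norml -[X in - X](avg_cst C L0) -avgN.
rewrite -[X in _ && (_ <= X)](avg_cst C L0).
by apply/andP; split; apply: avg_le => t; have := h t; rewrite ler_norml => /andP[].
Qed.

(** Abelian groups are amenable. Averages over finite sets [L + L'] are almost
    invariant under translation by [s] as soon as [L] contains a long
    progression [0, s, ..., n s], because [phi - phi (. + s)] telescopes
    along it; a limit of these averages along an ultrafilter is therefore
    invariant. *)
Lemma exists_invariant_mean : exists M, invariant_mean M.
Proof.
have [U [UU FU]] := ultraFilterLemma avg_filter_proper.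
have nearU (P : set ((G -> R) -> R)) :
    (forall L, L != [::] -> P (avg L)) -> \forall m \near U, P m.
  move=> PL; apply: FU; exists [:: 0] => // L' L'0; apply: PL.
  exact: sumset_neq0.
have cvgU phi : bounded_real phi -> cvg (m phi @[m --> U]).
  move=> [C hC]; apply: (@ultra_cvg _ _ _ C) => //; apply: nearU => L L0.
  exact: avg_norm.
pose M phi := lim (m phi @[m --> U]).
have near_lim phi (k : ((G -> R) -> R) -> R) l :
    (forall L, L != [::] -> avg L phi = k (avg L)) ->
    k m @[m --> U] --> l -> M phi = l.
  move=> phik kl; apply/cvg_lim => //; apply: cvg_trans kl.
  by apply: near_eq_cvg; apply: nearU => L L0; rewrite phik.
exists M; split.
- move=> phi psi bphi bpsi.
  apply: (near_lim _ (fun m => m phi + m psi)).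
    by move=> L L0; rewrite /avg big_split mulrDl.
  by apply: cvgD; exact: cvgU.
- move=> a phi bphi; apply: (near_lim _ (fun m => a * m phi)).
    by move=> L L0; rewrite /avg mulrA mulr_sumr.
  by apply: cvgM; [exact: cvg_cst|exact: cvgU].
- move=> phi psi bphi bpsi h; rewrite -subr_ge0.
  have cD : m psi - m phi @[m --> U] --> M psi - M phi.
    by apply: cvgB; exact: cvgU.
  rewrite -(cvg_lim _ cD)//; apply: limr_ge; first exact: cvgP cD.
  by apply: nearU => L L0; rewrite subr_ge0; exact: avg_le.
- move=> a; apply: (near_lim _ (fun=> a)); last exact: cvg_cst.
  by move=> L; exact: avg_cst.
- move=> phi s bphi; have [C hC] := bphi.
  have bphis : bounded_real (fun t => phi (t + s)) by exists C.
  have bdiff : bounded_real (fun t => phi (t + s) - phi t).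
    exists (C + C) => t; rewrite (le_trans (ler_normB _ _))//.
    by rewrite lerD.
  have C0 : 0 <= C by exact: (le_trans (normr_ge0 _) (hC 0)).
  apply/eqP; rewrite -subr_eq0.
  have <- : M (fun t => phi (t + s) - phi t) = M (fun t => phi (t + s)) - M phi.
    apply: (near_lim _ (fun m => m (fun t => phi (t + s)) - m phi)).
      by move=> L L0; rewrite /avg sumrB mulrBl.
    by apply: cvgB; exact: cvgU.
  rewrite -normr_le0; apply: le0_of_small => a a0.
  have [n n_gt0 na] : exists2 n : nat, (0 < n)%N & 2 * C / a < n%:R.
    by exists (Num.truncn (2 * C / a)).+1 => //; exact: truncnS_gt.
  have n0 : 0 < n%:R :> R by rewrite ltr0n.
  have bound : \forall m \near U, `|m (fun t => phi (t + s) - phi t)| <= a.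
    apply: FU; exists [seq s *+ i | i <- iota 0 n].
      by rewrite -size_eq0 size_map size_iota -lt0n.
    move=> L' L'0; rewrite /avg sum_sumset size_allpairs size_map size_iota.
    (* the sum over the progression telescopes *)
    rewrite exchange_big /=.
    under eq_bigr => b _.
      have -> : \sum_(j <- [seq s *+ i | i <- iota 0 n])
          (phi (j + b + s) - phi (j + b)) = phi (s *+ n + b) - phi b.
        rewrite big_map -[n in iota 0 n]subn0 -/(index_iota 0 n).
        under eq_bigr => i _ do rewrite addrAC -mulrSr.
        by rewrite telescope_sumr// add0r.
      over.
    rewrite natrM invfM mulrCA mulrC.
    have -> : (\sum_(b <- L') (phi (s *+ n + b) - phi b)) / (size L')%:R =
      avg L' (fun b => phi (s *+ n + b) - phi b) by [].
    rewrite normrM [`|_^-1|]ger0_norm ?invr_ge0 ?ler0n// ler_pdivrMr//.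
    rewrite (@le_trans _ _ (2 * C))//.
      apply: avg_norm => // t; rewrite (le_trans (ler_normB _ _))//.
      by rewrite mulr_natl mulr2n lerD.
    by move/ltW: na; rewrite ler_pdivrMr// [a * _]mulrC.
  have cd := cvgU _ bdiff.
  rewrite -/(M _) in cd *; rewrite ler_norml; apply/andP; split.
    apply: limr_ge => //; apply: filterS bound => m.
    by rewrite ler_norml => /andP[].
  apply: limr_le => //; apply: filterS bound => m.
  by rewrite ler_norml => /andP[].
Qed.

End InvariantMean.

(** * Isometric representations and totally bounded orbits *)

Section Representation.
Context (R : realType) (V : lmodType R[i]) (ip : V -> V -> R[i]).
Context (ipP : semi_inner_product ip).
Context (G : zmodType) (U : G -> V -> V).
Local Notation N := (sqnorm ip).

Record isometric_representation : Prop := IsometricRepresentation {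
  repD : forall t x y, U t (x + y) = U t x + U t y;
  repZ : forall t a x, U t (a *: x) = a *: U t x;
  rep0 : forall x, U 0 x = x;
  repM : forall s t x, U (s + t) x = U s (U t x);
  rep_ip : forall t x y, ip (U t x) (U t y) = ip x y }.

Hypothesis UP : isometric_representation.

Lemma repN t x : U t (- x) = - U t x.
Proof. by rewrite -scaleN1r (repZ UP) scaleN1r. Qed.

Lemma repB t x y : U t (x - y) = U t x - U t y.
Proof. by rewrite (repD UP) repN. Qed.

Lemma rep_sqnorm t x : N (U t x) = N x.
Proof. by rewrite /sqnorm (rep_ip UP). Qed.

Lemma rep_commute s t x : U s (U t x) = U t (U s x).
Proof. by rewrite -!(repM UP) addrC. Qed.

Lemma ip_rep_shift s t x y : ip (U t x) (U s y) = ip x (U (s - t) y).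
Proof. by rewrite -[RHS](rep_ip UP t) -(repM UP) [t + _]addrC subrK. Qed.

Lemma sqnorm_rep_diff s t x : N (U s x - U t x) = N (U (s - t) x - x).
Proof. by rewrite -[RHS](rep_sqnorm t) repB -(repM UP) [t + _]addrC subrK. Qed.

(** Total boundedness is phrased with colourings of the group, because
    finitely many colourings have a common refinement. *)
Definition totally_bounded_orbit x := forall e : R, 0 < e ->
  exists (I : finType) (c : G -> I),
    forall s t, c s = c t -> N (U s x - U t x) < e.

Lemma totally_bounded_orbit_joint (xs : seq V) (e : R) : 0 < e ->
  (forall x, x \in xs -> totally_bounded_orbit x) ->
  exists (I : finType) (c : G -> I),
    forall s t, c s = c t -> forall x, x \in xs -> N (U s x - U t x) < e.
Proof.
move=> e0; elim: xs => [|x xs IH] h; first by exists unit, (fun=> tt).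
have [|I [c hc]] := IH; first by move=> y yxs; apply: h; rewrite inE yxs orbT.
have [J [c' hc']] := h x (mem_head _ _) e e0.
exists (J * I)%type, (fun t => (c' t, c t)) => s t [/hc' ? /hc hxs] y.
by rewrite inE => /predU1P[->//|/hxs].
Qed.

Lemma finite_net (I : finType) (c : G -> I) :
  exists r : I -> G, forall s, c (r (c s)) = c s.
Proof.
pose r i := if pselect (exists s, c s = i) is left h then sval (cid h) else 0.
exists r => s; rewrite /r; case: pselect => [h|[]]; last by exists s.
by case: cid.
Qed.

(** Elements of the same colour differ by an element that almost fixes the
    given vectors, and [r] picks one representative of each colour. *)
Lemma totally_bounded_orbit_returns (xs : seq V) (e : R) : 0 < e ->
  (forall x, x \in xs -> totally_bounded_orbit x) ->
  exists (I : finType) (r : I -> G),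
    forall s, exists i, forall x, x \in xs -> N (U (s - r i) x - x) < e.
Proof.
move=> e0 /(totally_bounded_orbit_joint e0)[I [c hc]].
have [r rc] := finite_net c; exists I, r => s; exists (c s) => x xxs.
by rewrite -sqnorm_rep_diff hc.
Qed.

Lemma totally_bounded_orbit_limit x :
  (forall e : R, 0 < e -> exists2 y, totally_bounded_orbit y & N (x - y) < e) ->
  totally_bounded_orbit x.
Proof.
move=> h e e0; have e12 : 0 < e / 12 by rewrite divr_gt0.
have [y tby xy] := h _ e12; have [I [c hc]] := tby _ e12.
exists I, c => s t /hc st.
have := sqnormB ipP (U s x) (U t x) (U s y).
have := sqnormB ipP (U s y) (U t x) (U t y).
rewrite -!repB !rep_sqnorm (sqnormBC ipP y).
move: (N _) (N _) (N _) (N _) xy st => A B C D; lra.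
Qed.

Lemma totally_bounded_orbitD x y : totally_bounded_orbit x ->
  totally_bounded_orbit y -> totally_bounded_orbit (x + y).
Proof.
move=> tbx tby e e0; have e4 : 0 < e / 4 by rewrite divr_gt0.
have [I [c hc]] := tbx _ e4; have [J [c' hc']] := tby _ e4.
exists (I * J)%type, (fun t => (c t, c' t)) => s t [/hc hx /hc' hy].
rewrite !(repD UP) opprD addrACA.
rewrite (le_lt_trans (sqnormD ipP _ _))//; lra.
Qed.

Lemma totally_bounded_orbitZ a x : totally_bounded_orbit x ->
  totally_bounded_orbit (a *: x).
Proof.
move=> tbx e e0; have a1 : 0 < normc2 a + 1.
  by rewrite ltr_wpDl ?normc2_ge0.
have [I [c hc]] := tbx _ (divr_gt0 e0 a1).
exists I, c => s t /hc; rewrite !(repZ UP) -scalerBr (sqnormZ ipP).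
rewrite ltr_pdivlMr//; have := sqnorm_ge0 ipP (U s x - U t x); lra.
Qed.

(** Colour [t] by the cell of a fine grid that contains the eigenvalue. *)
Lemma totally_bounded_orbit_eigenvector (g : G -> R[i]) x :
  (forall t, normc2 (g t) = 1) -> (forall t, N (U t x - g t *: x) = 0) ->
  totally_bounded_orbit x.
Proof.
move=> g1 gx e e0.
have [k k0 ke] : exists2 k : nat, (0 < k)%N & 2 * N x / e < k%:R.
  by exists (Num.truncn (2 * N x / e)).+1 => //; exact: truncnS_gt.
have k0' : 0 < k%:R :> R by rewrite ltr0n.
(* the cells of length [1 / k] in the interval from -1 to 1 *)
pose q (a : R) : 'I_(2 * k).+1 := inord (Num.truncn ((a + 1) * k%:R)).
have qP (a b : R) : a ^+ 2 <= 1 -> b ^+ 2 <= 1 -> q a = q b ->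
    (a - b) ^+ 2 <= k%:R^-1 ^+ 2.
  have bnd (d : R) : d ^+ 2 <= 1 -> -1 <= d <= 1.
    by rewrite -ler_norml -(real_normK (num_real _)) expr_le1.
  move=> /bnd/andP[a1 a2] /bnd/andP[b1 b2] /(congr1 val) /=.
  have rng (d : R) : -1 <= d -> d <= 1 ->
      ((Num.truncn ((d + 1) * k%:R)) < (2 * k).+1)%N.
    move=> d1 d2; rewrite ltnS -(ler_nat R) natrM.
    rewrite (le_trans (_ : _ <= (d + 1) * k%:R))//.
      by rewrite truncn_le mulr_ge0//; lra.
    by rewrite ler_wpM2r//; lra.
  rewrite !inordK ?rng// => ab.
  have sa := truncn_itv (_ : 0 <= (a + 1) * k%:R).
  have sb := truncn_itv (_ : 0 <= (b + 1) * k%:R).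
  have /andP[sa1 sa2] := sa ltac:(rewrite mulr_ge0//; lra).
  have /andP[sb1 sb2] := sb ltac:(rewrite mulr_ge0//; lra).
  rewrite ab -natr1 in sa1 sa2; rewrite -natr1 in sb2.
  rewrite -(real_normK (num_real _)) ler_pXn2r ?nnegrE ?invr_ge0 ?ler0n//.
  rewrite -(ler_pM2r k0') mulVf ?gt_eqF// -[X in _ * X]ger0_norm ?ler0n//.
  rewrite -normrM ler_norml; apply/andP; split; lra.
exists ('I_(2 * k).+1 * 'I_(2 * k).+1)%type,
  (fun t => (q (complex.Re (g t)), q (complex.Im (g t)))) => s t [hre him].
have -> : N (U s x - U t x) = normc2 (g s - g t) * N x.
  have null : N ((U s x - g s *: x) - (U t x - g t *: x)) = 0.
    by rewrite (sqnormD_null ipP) ?gx// (sqnormN ipP) gx.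
  rewrite -(sqnormZ ipP) scalerBl -[RHS](sqnormD_null ipP _ null).
  by congr N; rewrite opprB addrACA [g s *: x + _]addrC subrK addKr.
have sq1 (z : R[i]) : normc2 z = 1 -> complex.Re z ^+ 2 <= 1 /\ complex.Im z ^+ 2 <= 1.
  by rewrite /normc2 => <-; rewrite lerDl lerDr !sqr_ge0.
have [s1 s2] := sq1 _ (g1 s); have [t1 t2] := sq1 _ (g1 t).
have : normc2 (g s - g t) <= 2 * k%:R^-1.
  have k1 : k%:R^-1 ^+ 2 <= k%:R^-1 :> R.
    by rewrite expr2 ler_piMr ?invr_ge0 ?ler0n// invf_le1// ler1n.
  have := qP _ _ s1 t1 hre; have := qP _ _ s2 t2 him.
  rewrite /normc2; case: (g s) (g t) => [a b] [c d] /=; lra.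
move=> /(ler_wpM2r (sqnorm_ge0 ipP x))/le_lt_trans; apply.
move: ke; rewrite ltr_pdivrMr// => ke.
by rewrite mulrAC ltr_pdivrMr// mulrC [X in _ < X]mulrC in ke *.
Qed.

End Representation.

(** * Compact quadratic forms *)

Section CompactForm.
Context (R : realType) (V : lmodType R[i]) (ip : V -> V -> R[i]).
Context (ipP : semi_inner_product ip).
Local Notation N := (sqnorm ip).

(** The last clause is compactness: up to a small multiple of the norm, the
    form only sees finitely many coordinates. *)
Record compact_form (Q : V -> R) : Prop := CompactForm {
  form_ge0 : forall x, 0 <= Q x;
  form_bounded : exists C, forall x, Q x <= C * N x;
  form_homogeneous : forall a x, Q (a *: x) = normc2 a * Q x;
  form_parallelogram : forall x y, Q (x + y) + Q (x - y) = 2 * Q x + 2 * Q y;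
  form_compact : forall e : R, 0 < e -> exists vs : seq V, forall x,
    Q x <= 2 * (\sum_(v <- vs) normc2 (ip x v)) + e * N x }.

Lemma form_sup (Q : V -> R) x0 : compact_form Q -> 0 < Q x0 ->
  exists l : R, [/\ 0 < l, forall x, Q x <= l * N x &
    forall d, 0 < d -> exists2 x, N x <= 1 & l - d < Q x].
Proof.
move=> QP Q0; have [C QC] := form_bounded QP.
have nz x : 0 < Q x -> 0 < N x.
  move=> Qx; rewrite lt_def (sqnorm_ge0 ipP) andbT; apply/eqP => x0E.
  by have := QC x; rewrite x0E mulr0 leNgt Qx.
have unit x : 0 < N x ->
    exists2 y, N y <= 1 & Q y = Q x / N x.
  move=> x_gt0; pose s := Num.sqrt (N x)^-1.
  have sE : normc2 s%:C = (N x)^-1.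
    by rewrite /normc2 /= expr0n /= addr0 sqr_sqrtr// invr_ge0 ltW.
  exists (s%:C *: x); first by rewrite (sqnormZ ipP) sE mulVf// gt_eqF.
  by rewrite (form_homogeneous QP) sE mulrC.
pose A := [set Q x | x in [set x | N x <= 1]].
have [y0 y01 y0E] := unit _ (nz _ Q0).
have supA : has_sup A.
  split; first by exists (Q y0), y0.
  exists `|C| => _ [x /= x1 <-]; rewrite (le_trans (QC x))//.
  rewrite (le_trans (ler_norm _))// normrM [`|N x|]ger0_norm ?(sqnorm_ge0 ipP)//.
  by rewrite ler_piMr.
exists (sup A); split.
- apply: (@lt_le_trans _ _ (Q y0)); first by rewrite y0E divr_gt0// nz.
  by apply: sup_upper_bound => //; exists y0.
- move=> x; have := sqnorm_ge0 ipP x; rewrite le_eqVlt => /predU1P[x0E|x_gt0].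
    by have := QC x; rewrite -x0E !mulr0.
  have [y y1 yE] := unit _ x_gt0; rewrite -ler_pdivrMr// -yE.
  by apply: sup_upper_bound => //; exists y.
- by move=> d d0; have [_ [x x1 <-] ?] := sup_adherent d0 supA; exists x => //.
Qed.

Definition form_defect (Q : V -> R) (l : R) x := l * N x - Q x.

Lemma form_defect_parallelogram Q l x y : compact_form Q ->
  form_defect Q l (x + y) + form_defect Q l (x - y) =
  2 * form_defect Q l x + 2 * form_defect Q l y.
Proof.
move=> QP; have := form_parallelogram QP x y; have := parallelogram ipP x y.
rewrite /form_defect => h1 h2.
have := congr1 (fun z => l * z) h1 => /= {}h1; lra.
Qed.

(** A compact form attains its norm. The almost maximisers [x] have small
    defect [l N x - Q x]; an ultrafilter on them makes the finitely many
    coordinates seen by [Q] converge, and since the defect is a nonnegative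
    quadratic form, vectors of small defect with close coordinates are close
    in norm. *)
Lemma compact_form_maximum (Q : V -> R) x0 : complete_sqnorm ip ->
  compact_form Q -> 0 < Q x0 ->
  exists l : R, [/\ 0 < l, forall x, Q x <= l * N x &
    exists2 x, 0 < N x & Q x = l * N x].
Proof.
move=> cV QP Q0; have [l [l0 Ql approx]] := form_sup QP Q0.
exists l; split => //.
(* almost maximisers in the unit ball; those of [E d] have defect below [d] *)
pose E (d : R) := [set x | N x <= 1 /\ l - d < Q x].
pose F : set_system V := [set S | exists2 d, 0 < d & E d `<=` S].
have FF : ProperFilter F.
  split; first by move=> [d /approx[x ? ?] /(_ x)]; apply.
  split; first by exists 1.
  - move=> S1 S2 [d1 d10 h1] [d2 d20 h2].
    exists (Num.min d1 d2); first by rewrite lt_min d10.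
    move=> x [x1 xl]; split; [apply: h1|apply: h2]; split => //;
      by rewrite (le_lt_trans _ xl)// lerD2l lerN2 ge_min lexx ?orbT.
  - by move=> S1 S2 S12 [d d0 h]; exists d => // x /h/S12.
have [W [WU FW]] := ultraFilterLemma FF.
have WE d : 0 < d -> W (E d) by move=> d0; apply: FW; exists d.
pose P := form_defect Q l.
have P0 x : 0 <= P x by rewrite subr_ge0.
have PE d x : E d x -> P x < d.
  move=> [x1 xl]; rewrite /P /form_defect.
  have : l * N x <= l by rewrite ler_piMr// ltW.
  by move: xl; lra.
have coord v (e : R) : 0 < e ->
    exists2 S, W S & forall x y, S x -> S y -> normc2 (ip (x - y) v) < e.
  move=> e0; have bnd x : N x <= 1 -> normc2 (ip x v) <= N v.
    move=> x1; rewrite (le_trans (cauchy_schwarz ipP _ _))//.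
    by rewrite ler_piMl// (sqnorm_ge0 ipP).
  have cvgW (h : R[i] -> R) : (forall z, h z ^+ 2 <= normc2 z) ->
      cvg (h (ip x v) @[x --> W]).
    move=> hz; apply: (@ultra_cvg _ _ _ _ (N v + 1)).
    apply: filterS (WE 1 ltr01) => x [x1 _].
    have := le_trans (hz _) (bnd _ x1); rewrite -(real_normK (num_real _)).
    have := normr_ge0 (h (ip x v)); move: `|_| (N v) => a b; nra.
  have cRe : cvg (complex.Re (ip x v) @[x --> W]).
    by apply: (cvgW (@complex.Re R)) => z; rewrite lerDl sqr_ge0.
  have cIm : cvg (complex.Im (ip x v) @[x --> W]).
    by apply: (cvgW (@complex.Im R)) => z; rewrite lerDr sqr_ge0.
  pose r := Num.sqrt (e / 16).
  have r0 : 0 < r by rewrite sqrtr_gt0 divr_gt0.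
  have rE : r ^+ 2 = e / 16 by rewrite sqr_sqrtr// ltW// divr_gt0.
  move: cRe cIm => /cvgrPdist_lt/(_ _ r0) wRe /cvgrPdist_lt/(_ _ r0) wIm.
  move: wRe wIm; set a := lim _; set b := lim _ => wRe wIm.
  exists [set x | `|a - complex.Re (ip x v)| < r /\
                  `|b - complex.Im (ip x v)| < r].
    exact: filterI.
  move=> x y [xa xb] [ya yb]; rewrite (ipBl ipP) /normc2.
  move: xa xb ya yb; case: (ip x v) (ip y v) => [x1 x2] [y1 y2] /=.
  rewrite !ltr_norml => /andP[? ?] /andP[? ?] /andP[? ?] /andP[? ?].
  have sq (c : R) : - (2 * r) < c -> c < 2 * r -> c ^+ 2 < e / 4.
    move=> c1 c2; have -> : e / 4 = (2 * r) ^+ 2 by rewrite exprMn rE; field.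
    nra.
  have := sq (x1 - y1) ltac:(lra) ltac:(lra).
  have := sq (x2 - y2) ltac:(lra) ltac:(lra).
  lra.
have coords (vs : seq V) (e : R) : 0 < e -> exists2 S, W S &
    forall x y, S x -> S y -> \sum_(v <- vs) normc2 (ip (x - y) v) < e.
  elim: vs e => [|v vs IH] e e0.
    by exists setT => [|x y _ _]; [exact: filterT|rewrite big_nil].
  have e2 : 0 < e / 2 by rewrite divr_gt0.
  have [S WS hS] := IH _ e2; have [S' WS' hS'] := coord v _ e2.
  exists (S `&` S'); first exact: filterI.
  move=> x y [Sx S'x] [Sy S'y]; rewrite big_cons [X in _ < X]splitr.
  by rewrite ltrD ?hS ?hS'.
have diam (e : R) : 0 < e ->
    exists2 S, W S & forall x y, S x -> S y -> N (x - y) < e.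
  move=> e0; pose d := e * l / 16; have d0 : 0 < d by rewrite divr_gt0// mulr_gt0.
  have [vs hvs] := form_compact QP d0.
  have [S WS hS] := coords vs d d0.
  exists (S `&` E d); first by apply: filterI => //; exact: WE.
  move=> x y [Sx Ex] [Sy Ey]; rewrite -(ltr_pM2l l0).
  have := hS _ _ Sx Sy; have := hvs (x - y).
  have := form_defect_parallelogram l x y QP; rewrite -/P.
  have := P0 (x + y); have := PE _ _ Ex; have := PE _ _ Ey.
  have -> : l * N (x - y) = P (x - y) + Q (x - y).
    by rewrite /P /form_defect subrK.
  have N4 : N (x - y) <= 4.
    have := sqnormD ipP x (- y); rewrite (sqnormN ipP).
    by case: Ex Ey => [? _] [? _]; lra.
  have := ler_wpM2l (ltW d0) N4.
  have -> : l * e = 16 * d by rewrite /d; field.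
  lra.
have hdiam n : {S | W S /\ forall x y, S x -> S y -> N (x - y) < n.+1%:R^-1}.
  by apply: cid; have [S ? ?] := diam n.+1%:R^-1 ltac:(by []); exists S.
pose C n := [set x | forall k, (k <= n)%N ->
  (projT1 (hdiam k) `&` E k.+1%:R^-1) x].
have [g Cg] : exists g, forall n (e : R), 0 < e ->
    exists2 y, C n y & N (y - g) < e.
  apply: cantor_intersection => //.
  - move=> n; apply: (@filter_ex _ W).
    elim: n => [|n IH].
      have : W (projT1 (hdiam 0%N) `&` E 1^-1).
        by apply: filterI; [case: (projT2 (hdiam 0%N))|apply: WE; rewrite invr1].
      by apply: filterS => x Sx k; rewrite leqn0 => /eqP ->.
    have : W (projT1 (hdiam n.+1) `&` E n.+2%:R^-1).
      by apply: filterI; [case: (projT2 (hdiam n.+1))|apply: WE].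
    apply: filterS2 IH => x Cx Sx k; rewrite leq_eqVlt => /predU1P[->//|].
    exact: Cx.
  - by move=> m n mn x Cx k km; apply: Cx; exact: leq_trans mn.
  - move=> e e0; exists (Num.truncn e^-1) => x y /(_ _ (leqnn _))[Sx _].
    move=> /(_ _ (leqnn _))[Sy _].
    have [_ /(_ _ _ Sx Sy)] := projT2 (hdiam (Num.truncn e^-1)).
    move/lt_le_trans; apply; rewrite invf_ple ?posrE//.
    by rewrite ltW// truncnS_gt.
have PD x y : P (x + y) <= 2 * P x + 2 * P y.
  by rewrite -(form_defect_parallelogram l x y QP) lerDl P0.
have PN x : P x <= l * N x by rewrite /P /form_defect lerBlDr lerDl (form_ge0 QP).
have small (d : R) : 0 < d -> exists2 y, E d y & N (y - g) < d.
  move=> d0; have [y Cy yg] := Cg (Num.truncn d^-1) d d0; exists y => //.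
  have [_ [y1 yl]] := Cy _ (leqnn _); split=> //.
  rewrite (le_lt_trans _ yl)// lerD2l lerN2 invf_ple ?posrE//.
  by rewrite ltW// truncnS_gt.
exists g.
  pose d := Num.min (l / 4) (1 / 4).
  have d0 : 0 < d by rewrite lt_min !divr_gt0.
  have dl : d <= l / 4 by rewrite ge_min lexx.
  have d4 : d <= 1 / 4 by rewrite ge_min lexx orbT.
  have [y [y1 yl] yg] := small d d0.
  have := sqnormD ipP (y - g) g; rewrite subrK.
  have : 3 / 4 <= N y by rewrite -(ler_pM2l l0); have := Ql y; lra.
  lra.
apply/eqP; rewrite eq_sym -subr_eq0 -[_ - _]/(P g) eq_le P0 andbT.
apply: le0_of_small => a a0.
pose d := a / (2 * (l + 1)).
have l1 : 0 < 2 * (l + 1) by rewrite mulr_gt0// addr_gt0.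
have [y Ey yg] := small d (divr_gt0 a0 l1).
have := PD y (g - y); rewrite addrC subrK.
have := PE _ _ Ey; have := PN (g - y); rewrite (sqnormBC ipP).
have := ltW yg => /(ler_wpM2l (ltW l0)).
have -> : a = 2 * d + 2 * (l * d) by rewrite /d; field; lra.
lra.
Qed.

End CompactForm.

(** * Common eigenvectors *)

Section CommonEigenvector.
Context (R : realType) (V : lmodType R[i]) (ip : V -> V -> R[i]).
Context (ipP : semi_inner_product ip).
Local Notation N := (sqnorm ip).

Definition linear_subspace (F : set V) : Prop :=
  [/\ F 0, forall x y, F x -> F y -> F (x + y) & forall a x, F x -> F (a *: x)].

(** The vectors [vs] separate the points of [F] up to vectors of norm zero;
    then [F] has dimension at most [size vs] modulo such vectors. *)
Definition separated_by (F : set V) (vs : seq V) : Prop :=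
  forall x, F x -> (forall v, v \in vs -> ip x v = 0) -> N x = 0.

Lemma subspace_sum (F : set V) (I : Type) (r : seq I) (f : I -> V) :
  linear_subspace F -> (forall i, F (f i)) -> F (\sum_(i <- r) f i).
Proof. by move=> [F0 FD _] Ff; elim/big_ind: _. Qed.

(** Some [v] in [vs] does not vanish at [y]. Corrected by multiples of [v] so
    as to vanish at [y], the remaining vectors separate [F']: a vector of [F']
    that they do not see becomes null after adding a multiple of [y], and
    that multiple is zero because [y] is not in [F']. *)
Lemma separated_drop (F F' : set V) (vs : seq V) y : linear_subspace F ->
  linear_subspace F' -> F' `<=` F ->
  (forall x z, F' x -> N (z - x) = 0 -> F z -> F' z) ->
  separated_by F vs -> F y -> ~ F' y ->
  exists2 ws, separated_by F' ws & (size ws < size vs)%N.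
Proof.
move=> [F0 FD FZ] [F'0 _ F'Z] F'F F'null sep Fy nF'y.
have [v vvs yv] : exists2 v, v \in vs & ip y v != 0.
  apply: contrapT => h; apply: nF'y; apply: (F'null 0) => //.
  rewrite subr0; apply: sep => // v vvs; apply/eqP.
    by apply/negPn/negP => yv; apply: h; exists v.
pose w u := u - conjc (ip y u / ip y v) *: v.
have yw u : ip y (w u) = 0.
  by rewrite (ipBr ipP) (ipZr ipP) conjcK mulfVK// subrr.
exists (map w (rem v vs)); last first.
  by rewrite size_map size_rem// ltn_predL; case: (vs) vvs.
move=> x F'x hx.
pose c := - (ip x v / ip y v).
have xy0 : N (x + c *: y) = 0.
  apply: sep; first by apply: FD; [exact: F'F|exact: FZ].
  have zv : ip (x + c *: y) v = 0.
    by rewrite (ipDl ipP) (ipZl ipP) mulNr mulfVK// subrr.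
  move=> u uvs; have [->//|uv] := eqVneq u v.
  have : ip (x + c *: y) (w u) = 0.
    rewrite (ipDl ipP) (ipZl ipP) yw mulr0 addr0; apply: hx.
    apply: map_f; move: uvs; rewrite (perm_mem (perm_to_rem vvs)) inE.
    by rewrite (negPf uv).
  by rewrite (ipBr ipP) (ipZr ipP) zv mulr0 subr0.
have [c0|c0] := eqVneq c 0; first by rewrite -xy0 c0 scale0r addr0.
exfalso; apply: nF'y; apply: (F'null (- c^-1 *: x)) => //; first exact: F'Z.
have -> : y - - c^-1 *: x = c^-1 *: (x + c *: y).
  by rewrite scalerDr scalerA mulVf// scale1r scaleNr opprK addrC.
by rewrite (sqnormZ ipP) xy0 mulr0.
Qed.

Section Eigenvector.
Variable T : V -> V.
Hypothesis TD : forall x y, T (x + y) = T x + T y.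
Hypothesis TZ : forall a x, T (a *: x) = a *: T x.

Definition poly_act (p : {poly R[i]}) (x : V) : V :=
  \sum_(i < size p) p`_i *: iter i T x.

Lemma poly_actE n (p : {poly R[i]}) x : (size p <= n)%N ->
  poly_act p x = \sum_(i < n) p`_i *: iter i T x.
Proof.
move=> pn; rewrite /poly_act -!(big_mkord xpredT (fun i => p`_i *: iter i T x)).
rewrite (big_cat_nat _ pn)//= [X in _ = _ + X]big_nat_cond [X in _ = _ + X]big1 ?addr0//.
by move=> i /andP[/andP[pi _] _]; rewrite nth_default// scale0r.
Qed.

Lemma poly_act_factor (q : {poly R[i]}) z x :
  poly_act (q * ('X - z%:P)) x = T (poly_act q x) - z *: poly_act q x.
Proof.
pose n := (size q).+2.
have T0 : T 0 = 0 by rewrite -[X in T X](scale0r (0 : V)) TZ scale0r.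
rewrite (@poly_actE n); last first.
  by rewrite (leq_trans (size_polyMleq _ _))// size_XsubC addn2.
rewrite {1}(@poly_actE (size q).+1)// (@poly_actE n q)//; last first.
  by rewrite /n (leqW (leqnSn _)).
rewrite (big_morph T TD T0) scaler_sumr.
have -> : \sum_(i < (size q).+1) T (q`_i *: iter i T x) =
    \sum_(i < n) ('X * q)`_i *: iter i T x.
  rewrite /n [RHS]big_ord_recl coefXM eqxx scale0r add0r.
  by apply: eq_bigr => i _; rewrite TZ coefXM.
rewrite -sumrB; apply: eq_bigr => i _.
by rewrite mulrBr coefB [q * 'X]mulrC coefMC scalerBl scalerA [z * _]mulrC.
Qed.

(** The iterates of [x] are dependent modulo null vectors, so a nonzero
    polynomial in [T] annihilates [x]. Splitting off linear factors, the last
    vector that is not null is an eigenvector. *)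
Lemma exists_eigenvector (F : set V) (vs : seq V) x : linear_subspace F ->
  (forall y, F y -> F (T y)) -> (forall y, N y = 0 -> N (T y) = 0) ->
  separated_by F vs -> F x -> 0 < N x ->
  exists z y, [/\ F y, 0 < N y & N (T y - z *: y) = 0].
Proof.
move=> subF FT Tnull sep Fx x0.
have Fact p : F (poly_act p x).
  have Fi i : F (iter i T x) by elim: i => //= i; exact: FT.
  by apply: subspace_sum => // i; case: subF => _ _; apply.
have pos y : N y <> 0 -> 0 < N y.
  by move=> /eqP y0; rewrite lt_def y0 (sqnorm_ge0 ipP).
have [p p0 px] : exists2 p, p != 0 & N (poly_act p x) = 0.
  set n := size vs.
  (* more iterates than coordinates *)
  pose A : 'M[R[i]]_(n.+1, n) := \matrix_(i, j) ip (iter i T x) vs`_j.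
  have [c cA c0] : exists2 c : 'rV_n.+1, c *m A = 0 & c != 0.
    have : kermx A != 0.
      rewrite kermx_eq0 /row_free; apply/eqP => rA.
      by have := rank_leq_col A; rewrite rA ltnn.
    by case/rowV0Pn => c /sub_kermxP cA c0; exists c.
  exists (rVpoly c); first by rewrite -[0](linear0 (@rVpoly _ n.+1)) (inj_eq (can_inj rVpolyK)).
  apply: sep => // v /(nthP 0)[j jn <-].
  have := congr1 (fun B : 'rV_n => B 0 (Ordinal jn)) cA.
  rewrite !mxE => <-; rewrite (@poly_actE n.+1); last first.
    by rewrite /rVpoly size_poly.
  rewrite (big_morph (ip ^~ vs`_j) (id1 := 0) (op1 := +%R)); last 2 first.
  - by move=> ? ?; rewrite (ipDl ipP).
  - by rewrite (ip0l ipP).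
  by apply: eq_bigr => i _; rewrite (ipZl ipP) mxE coef_rVpoly_ord.
have [n] := ubnP (size p); elim: n p p0 px => // n IH p p0 px pn.
have [p1|p1] := eqVneq (size p) 1%N.
  move: px; rewrite /poly_act p1 big_ord1 (sqnormZ ipP) /= => /eqP.
  rewrite mulf_eq0 (gt_eqF x0) orbF => /eqP/normc2_eq0 pE.
  by move: p0; rewrite -lead_coef_eq0 lead_coefE p1 pE eqxx.
have [z /factor_theorem[q pE]] := closed_rootP p p1.
have q0 : q != 0 by apply: contraNneq p0 => q0; rewrite pE q0 mul0r.
have qp : (size q < size p)%N.
  by rewrite pE size_Mmonic ?monicXsubC// size_XsubC addn2.
have [qx|qx] := pselect (N (poly_act q x) = 0).
  by apply: IH qx _ => //; exact: leq_trans qp _.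
exists z, (poly_act q x); split => //; first exact: pos.
by rewrite -poly_act_factor -pE.
Qed.

End Eigenvector.

Context (G : zmodType) (U : G -> V -> V).
Hypothesis UP : isometric_representation ip U.

(** If some [U t] is not a scalar on [F], then one of its eigenspaces in [F]
    is a proper invariant subspace, which fewer vectors separate. *)
Lemma representation_common_eigenvector (F : set V) (vs : seq V) x : linear_subspace F ->
  (forall t y, F y -> F (U t y)) -> separated_by F vs -> F x -> 0 < N x ->
  exists2 g, F g /\ 0 < N g & forall t, exists z, N (U t g - z *: g) = 0.
Proof.
have [n] := ubnP (size vs); elim: n vs F x => // n IH vs F x vsn.
move=> subF FU sep Fx x0.
have [F0 FD FZ] := subF.
pose F' t z := [set y | F y /\ N (U t y - z *: y) = 0].
have [[t [z [[y [F'y y0]] [y' [Fy' nF'y']]]]]|scalar] := pselect (exists t z,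
  (exists y, F' t z y /\ 0 < N y) /\ exists y', F y' /\ ~ F' t z y').
  have F'Z a u : F' t z u -> F' t z (a *: u).
    move=> [Fu uz]; split; first exact: FZ.
    by rewrite (repZ UP) scalerA mulrC -scalerA -scalerBr (sqnormZ ipP) uz mulr0.
  have sub' : linear_subspace (F' t z).
    split=> [|u v [Fu uz] [Fv vz]|//].
      by split=> //; rewrite -(scale0r 0) (repZ UP) !scale0r scaler0 subrr (sqnorm0 ipP).
    split; first exact: FD.
    by rewrite (repD UP) scalerDr opprD addrACA (sqnormD_null ipP).
  have [ws sepw wsn] : exists2 ws, separated_by (F' t z) ws & (size ws < size vs)%N.
    apply: (separated_drop subF sub' _ _ sep Fy') => //; first by move=> u [].
    move=> u v [Fu uz] vu Fv; split=> //.
    have -> : U t v - z *: v = (U t u - z *: u) + (U t (v - u) - z *: (v - u)).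
      rewrite (repB UP) scalerBr addrACA -[X in _ = _ + X]opprD.
      by rewrite [z *: u + _]addrC subrK [U t u + _]addrC subrK.
    rewrite (sqnormD_null ipP)//.
    by rewrite (sqnormD_null ipP) ?(sqnormN ipP) ?(sqnormZ ipP) ?(rep_sqnorm UP) vu ?mulr0.
  have [||g [[Fg _] g0] gU] := IH ws (F' t z) y _ sub' _ sepw F'y y0.
  - exact: leq_trans wsn _.
  - move=> s u [Fu uz]; split; first exact: FU.
    by rewrite (rep_commute UP) -(repZ UP) -(repB UP) (rep_sqnorm UP).
  - by exists g.
exists x => // t.
have Unull u : N u = 0 -> N (U t u) = 0 by rewrite (rep_sqnorm UP).
have [z [y [Fy y0 yz]]] := exists_eigenvector (repD UP t) (repZ UP t)
  subF (FU t) Unull sep Fx x0.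
exists z; apply: contrapT => xz; apply: scalar; exists t, z; split.
  by exists y.
by exists x; split => // -[_].
Qed.

End CommonEigenvector.

(** * Eigenvectors in a totally bounded orbit *)

Section OrbitForm.
Context (R : realType) (V : lmodType R[i]) (ip : V -> V -> R[i]).
Context (ipP : semi_inner_product ip).
Context (G : zmodType) (U : G -> V -> V).
Context (UP : isometric_representation ip U).
Context (M : (G -> R) -> R) (MP : invariant_mean M).
Local Notation N := (sqnorm ip).

Lemma bounded_realD (a b : G -> R) : bounded_real a -> bounded_real b ->
  bounded_real (fun t => a t + b t).
Proof.
move=> [A hA] [B hB]; exists (A + B) => t.
by rewrite (le_trans (ler_normD _ _))// lerD.
Qed.

Lemma bounded_real_sum (I : Type) (r : seq I) (a : I -> G -> R) :
  (forall i, bounded_real (a i)) -> bounded_real (fun t => \sum_(i <- r) a i t).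
Proof.
move=> ba; elim: r => [|i r IH].
  by exists 0 => t; rewrite big_nil normr0.
rewrite (_ : (fun t => _) = (fun t => a i t + \sum_(j <- r) a j t)).
  exact: bounded_realD.
by apply/funext => t; rewrite big_cons.
Qed.

Lemma mean_sum (I : Type) (r : seq I) (a : I -> G -> R) :
  (forall i, bounded_real (a i)) ->
  M (fun t => \sum_(i <- r) a i t) = \sum_(i <- r) M (a i).
Proof.
move=> ba; elim: r => [|i r IH].
  rewrite big_nil -[RHS](mean_cst MP); congr M.
  by apply/funext => t; rewrite big_nil.
rewrite big_cons -IH -(meanD MP)//; last exact: bounded_real_sum.
by congr M; apply/funext => t; rewrite big_cons.
Qed.

Lemma bounded_realZ c (a : G -> R) : bounded_real a ->
  bounded_real (fun t => c * a t).
Proof.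
move=> [A hA]; exists (`|c| * A) => t.
by rewrite normrM ler_wpM2l.
Qed.

Lemma bounded_real_cst (c : R) : bounded_real (fun _ : G => c).
Proof. by exists `|c|. Qed.

Variable f : V.

Definition orbit_coord x (s : G) : R := normc2 (ip x (U s f)).

(** The quadratic form of the averaged rank one operators
    [x |-> <x, U s f> U s f]. *)
Definition orbit_form x : R := M (orbit_coord x).

Lemma orbit_coord_bound x s : orbit_coord x s <= N x * N f.
Proof.
by rewrite /orbit_coord (le_trans (cauchy_schwarz ipP _ _))// (rep_sqnorm UP).
Qed.

Lemma bounded_orbit_coord x : bounded_real (orbit_coord x).
Proof.
by exists (N x * N f) => s; rewrite ger0_norm ?normc2_ge0// orbit_coord_bound.
Qed.
Local Hint Resolve bounded_orbit_coord : core.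

Lemma orbit_formU t x : orbit_form (U t x) = orbit_form x.
Proof.
rewrite /orbit_form -[RHS](mean_shift MP (- t))//; congr M.
by apply/funext => s; rewrite /orbit_coord (ip_rep_shift UP).
Qed.

Lemma orbit_form_orthogonal x b c :
  (forall t, ip b (U t f) = 0) -> orbit_form (x + c *: b) = orbit_form x.
Proof.
move=> bf; congr M; apply/funext => s.
by rewrite /orbit_coord (ipDl ipP) (ipZl ipP) bf mulr0 addr0.
Qed.

Hypothesis tbf : totally_bounded_orbit ip U f.

Lemma orbit_net (e : R) : 0 < e ->
  exists (I : finType) (r : I -> G), forall s, exists i, N (U s f - U (r i) f) < e.
Proof.
move=> /tbf[I [c hc]]; have [r rc] := finite_net c.
by exists I, r => s; exists (c s); apply: hc; rewrite rc.
Qed.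

(** Each coordinate along the orbit is close to one along a finite net. *)
Lemma orbit_form_compact : compact_form ip orbit_form.
Proof.
split.
- move=> x; rewrite -(mean_cst MP 0); apply: (mean_le MP) => //.
    exact: bounded_real_cst.
  by move=> t; exact: normc2_ge0.
- exists (N f) => x; rewrite -[leRHS](mean_cst MP); apply: (mean_le MP) => //.
    exact: bounded_real_cst.
  by move=> t; rewrite mulrC; exact: orbit_coord_bound.
- move=> a x; rewrite -(meanZ MP)//; congr M; apply/funext => s.
  by rewrite /orbit_coord (ipZl ipP) normc2M.
- move=> x y; rewrite -!(meanZ MP)// -!(meanD MP)//; [|exact: bounded_realZ..].
  congr M; apply/funext => s; rewrite /orbit_coord (ipDl ipP) (ipBl ipP).
  by case: (ip x _) (ip y _) => [a b] [c d]; rewrite /normc2 /=; ring.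
- move=> e e0; have [I [r hr]] := orbit_net (divr_gt0 e0 (ltr0n R 2)).
  exists [seq U (r i) f | i <- enum I] => x; rewrite big_map.
  rewrite big_enum /= -[leRHS](mean_cst MP); apply: (mean_le MP) => //.
    exact: bounded_real_cst.
  move=> s; have [i si] := hr s.
  have -> : orbit_coord x s = normc2 (ip x (U s f - U (r i) f) + ip x (U (r i) f)).
    by rewrite -(ipDr ipP) subrK.
  rewrite (le_trans (normc2D _ _))// addrC lerD//.
    rewrite ler_pM2l// (bigD1 i)//= lerDl sumr_ge0// => j _.
    exact: normc2_ge0.
  have := cauchy_schwarz ipP x (U s f - U (r i) f).
  have := ler_wpM2l (sqnorm_ge0 ipP x) (ltW si).
  lra.
Qed.

(** Every point of the orbit is close to a point of a finite net, so the
    translates of [|<f, U s f>|^2] by the net add up to a function of [s] that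
    is bounded below. Its mean is a multiple of the value of the form at [f]. *)
Lemma orbit_form_gt0 : 0 < N f -> 0 < orbit_form f.
Proof.
move=> f0; have [I [r hr]] := orbit_net f0.
have lb s : N f ^+ 2 / 4 <= \sum_(i : I) orbit_coord (U (r i) f) s.
  have [i si] := hr s.
  rewrite (bigD1 i)//=; apply: ler_wpDr.
    by rewrite sumr_ge0// => j _; exact: normc2_ge0.
  have := sqnormDE ipP (U (r i) f) (- U s f).
  rewrite (sqnormBC ipP) (sqnormN ipP) !(rep_sqnorm UP) (ipNr ipP) /orbit_coord.
  move: si; case: (ip _ _) => a b; rewrite /normc2 /= => si ab.
  have : N f / 2 <= a by lra.
  have := sqr_ge0 b; nra.
rewrite lt_def (form_ge0 orbit_form_compact) andbT; apply/eqP => Q0.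
have : N f ^+ 2 / 4 <= \sum_(i : I) orbit_form (U (r i) f).
  rewrite -(mean_sum _ (fun i => bounded_orbit_coord (U (r i) f))).
  rewrite -[leLHS](mean_cst MP); apply: (mean_le MP) => //.
    exact: bounded_real_cst.
  by apply: bounded_real_sum => i.
rewrite big1 => [|i _]; last by rewrite orbit_formU.
by rewrite leNgt divr_gt0// exprn_gt0.
Qed.

End OrbitForm.

Section EigenvectorFromOrbit.
Context (R : realType) (V : lmodType R[i]) (ip : V -> V -> R[i]).
Context (ipP : semi_inner_product ip) (cV : complete_sqnorm ip).
Context (G : zmodType) (U : G -> V -> V).
Context (UP : isometric_representation ip U).
Local Notation N := (sqnorm ip).

(** The maximisers of the orbit form are an invariant subspace of finite
    dimension. A vector [b] orthogonal to the orbit can be added to any vector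
    without changing the form, so it is orthogonal to the maximisers. *)
Theorem eigenvector_from_orbit f : 0 < N f -> totally_bounded_orbit ip U f ->
  exists2 g, 0 < N g &
    (forall t, exists z, N (U t g - z *: g) = 0) /\
    (forall b, (forall t, ip b (U t f) = 0) -> ip g b = 0).
Proof.
move=> f0 tbf; have [M MP] := exists_invariant_mean R G.
pose Q := orbit_form ip U M f.
have QP : compact_form ip Q := orbit_form_compact ipP UP MP tbf.
have [l [l0 Ql [x x0 xl]]] :=
  compact_form_maximum ipP cV QP (orbit_form_gt0 ipP UP MP tbf f0).
pose F := [set y | Q y = l * N y].
have subF : linear_subspace F.
  have PF y : F y <-> form_defect ip Q l y = 0.
    by rewrite /form_defect /F /=; split => [->|/eqP]; rewrite ?subrr// subr_eq0 => /eqP.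
  have P0 y : 0 <= form_defect ip Q l y by rewrite subr_ge0.
  split.
  - apply/PF/eqP; rewrite eq_le P0 andbT /form_defect (sqnorm0 ipP) mulr0.
    by rewrite sub0r oppr_le0 (form_ge0 QP).
  - move=> y z /PF y0 /PF z0; apply/PF/eqP; rewrite eq_le P0 andbT.
    have := form_defect_parallelogram ipP l y z QP; have := P0 (y - z).
    rewrite y0 z0; lra.
  - by move=> a y Fy; rewrite /F /= (form_homogeneous QP) Fy (sqnormZ ipP) mulrCA.
have FU t y : F y -> F (U t y).
  by rewrite /F /Q /= (orbit_formU ipP UP MP) (rep_sqnorm UP).
have [vs hvs] := form_compact QP (divr_gt0 l0 (ltr0n R 2)).
have sep : separated_by ip F vs.
  move=> y Fy yv; apply/eqP; rewrite eq_le (sqnorm_ge0 ipP) andbT.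
  rewrite -(pmulr_rle0 _ l0); have := hvs y; rewrite Fy big_seq big1; first lra.
  by move=> v /yv ->; rewrite /normc2 /= expr0n addr0.
have [g [Fg g0] gU] := representation_common_eigenvector ipP UP subF FU sep xl x0.
exists g => //; split=> // b bf; apply: normc2_eq0; apply/eqP.
rewrite eq_le normc2_ge0 andbT -(mul0r (N b)).
apply: (almost_minimal_orthogonal ipP) => c; rewrite subr0 -(ler_pM2l l0) -Fg.
rewrite -[Q g](orbit_form_orthogonal ipP M g c bf); exact: Ql.
Qed.

End EigenvectorFromOrbit.

(** * Orthonormal bases of eigenvectors *)

Section EigenvectorBasis.
Context (R : realType) (V : lmodType R[i]) (ip : V -> V -> R[i]).
Context (ipP : semi_inner_product ip) (cV : complete_sqnorm ip).
Context (G : zmodType) (U : G -> V -> V).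
Context (UP : isometric_representation ip U).
Local Notation N := (sqnorm ip).

Definition common_eigen x := forall t, exists z, N (U t x - z *: x) = 0.

Definition orthonormal_eigenvectors (S : set V) :=
  [/\ forall x, S x -> ip x x = 1, forall x, S x -> common_eigen x &
      forall x y, S x -> S y -> x <> y -> ip x y = 0].

Lemma ip_eigenvector z x y u : N (x - z *: y) = 0 -> ip x u = z * ip y u.
Proof.
move=> xy; apply/eqP; rewrite -subr_eq0 -(ipZl ipP) -(ipBl ipP).
by rewrite (ipC ipP) (ip_null ipP _ xy) rmorph0.
Qed.

Lemma normalise_eigenvector g : 0 < N g -> common_eigen g ->
  exists2 a : R[i], ip (a *: g) (a *: g) = 1 & common_eigen (a *: g).
Proof.
move=> g0 gU; exists (Num.sqrt (N g)^-1)%:C; last first.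
  move=> t; have [z zt] := gU t; exists z.
  by rewrite (repZ UP) scalerA mulrC -scalerA -scalerBr (sqnormZ ipP) zt mulr0.
rewrite (ip_sqnorm ipP) (sqnormZ ipP) /normc2 /= expr0n addr0.
by rewrite sqr_sqrtr ?invr_ge0 ?(ltW g0)// mulVf// gt_eqF.
Qed.

Lemma orthonormal_eigenvectors_extend S g : orthonormal_eigenvectors S ->
  ip g g = 1 -> common_eigen g -> (forall b, S b -> ip g b = 0) ->
  orthonormal_eigenvectors (S `|` [set g]).
Proof.
move=> [S1 SU So] g1 gU gS; split.
- by move=> x [/S1|->].
- by move=> x [/SU|->].
- move=> x y [Sx|->] [Sy|->] xy //; first exact: So.
  + by rewrite (ipC ipP) gS// rmorph0.
  + exact: gS.
Qed.

Lemma exists_maximal_orthonormal_eigenvectors : exists S,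
  orthonormal_eigenvectors S /\
  forall S', S `<` S' -> ~ orthonormal_eigenvectors S'.
Proof.
apply: Zorn_bigcup => F FP Ftot; split.
- by move=> x [S FS Sx]; case: (FP S FS) => + _ _; apply.
- by move=> x [S FS Sx]; case: (FP S FS) => _ + _; apply.
- move=> x y [S FS Sx] [S' FS' S'y].
  have [SS'|S'S] := Ftot _ _ FS FS'.
    by case: (FP S' FS') => _ _; apply => //; exact: SS'.
  by case: (FP S FS) => _ _; apply => //; exact: S'S.
Qed.

(** The orthogonal complement of a maximal orthonormal system of eigenvectors
    is invariant; a nonzero vector there would produce another eigenvector
    orthogonal to the system. *)
Theorem eigenvector_basis : (forall x, totally_bounded_orbit ip U x) ->
  exists2 S, orthonormal_eigenvectors S &
    forall x (e : R), 0 < e -> exists2 r : seq (R[i] * V),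
      (forall p, p \in r -> S p.2) & N (x - \sum_(p <- r) p.1 *: p.2) < e.
Proof.
move=> tb; have [S [SP Smax]] := exists_maximal_orthonormal_eigenvectors.
exists S => // x e e0; apply: contrapT => h.
pose W := [set s | exists2 r : seq (R[i] * V),
  (forall p, p \in r -> S p.2) & s = \sum_(p <- r) p.1 *: p.2].
have [||||y y0 yW] := @orthogonal_component _ _ _ ipP W x e cV _ _ _ e0.
- by exists [::]; rewrite ?big_nil.
- move=> _ _ [r hr ->] [r' hr' ->]; exists (r ++ r'); last by rewrite big_cat.
  by move=> p; rewrite mem_cat => /orP[/hr|/hr'].
- move=> a _ [r hr ->]; exists [seq (a * p.1, p.2) | p <- r].
    by move=> _ /mapP[p /hr ? ->].
  rewrite big_map scaler_sumr; apply: eq_bigr => p _ /=.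
  by rewrite scalerA.
- move=> _ [r hr ->]; rewrite leNgt; apply/negP => xr; apply: h.
  by exists r.
have [S1 SU So] := SP.
have yS b : S b -> ip y b = 0.
  move=> Sb; apply: yW; exists [:: (1, b)]; last by rewrite big_seq1 scale1r.
  by move=> p; rewrite inE => /eqP ->.
have [g g0 [gU gy]] := eigenvector_from_orbit ipP cV UP y0 (tb y).
have gS b : S b -> ip g b = 0.
  move=> Sb; apply: gy => t; have [z bz] := SU b Sb (- t).
  rewrite -(rep_ip UP (- t)) -(repM UP) addNr (rep0 UP).
  by rewrite (ip_eigenvector _ bz) (ipC ipP) yS// rmorph0 mulr0.
have [a ag1 agU] := normalise_eigenvector g0 gU.
have agS b : S b -> ip (a *: g) b = 0.
  by move=> Sb; rewrite (ipZl ipP) gS// mulr0.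
apply: (Smax (S `|` [set a *: g])); last first.
  exact: orthonormal_eigenvectors_extend.
rewrite properEneq; split; last exact: subsetUl.
apply/eqP => SE; have Sag : S (a *: g) by rewrite SE; right.
by move/eqP: ag1; rewrite agS// eq_sym oner_eq0.
Qed.

End EigenvectorBasis.

(** * Square integrable functions *)

Section SquareIntegrable.
Context d (T : measurableType d) (R : realType) (P : probability T R).
Implicit Types u v : T -> R.

Definition square_integrable u : Prop :=
  measurable_fun [set: T] u /\
  P.-integrable [set: T] (EFin \o (fun x => u x ^+ 2)).

Lemma fine_probability_setT : fine (P [set: T]) = 1.
Proof. by have -> : P [set: T] = 1%E by exact: probability_setT. Qed.

Lemma le_integrable_real (g h : T -> R) : measurable_fun [set: T] g ->
  (forall x, `|g x| <= h x) -> P.-integrable [set: T] (EFin \o h) ->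
  P.-integrable [set: T] (EFin \o g).
Proof.
move=> mg gh; apply: le_integrable => //; first exact/measurable_EFinP.
by move=> x _ /=; rewrite lee_fin (le_trans (gh x))// ler_norm.
Qed.

Lemma integrable_realD (g h : T -> R) :
  P.-integrable [set: T] (EFin \o g) -> P.-integrable [set: T] (EFin \o h) ->
  P.-integrable [set: T] (EFin \o (fun x => g x + h x)).
Proof. by move=> ig ih; have := integrableD measurableT ig ih. Qed.

Lemma integrable_realZ a (g : T -> R) :
  P.-integrable [set: T] (EFin \o g) ->
  P.-integrable [set: T] (EFin \o (fun x => a * g x)).
Proof. by move=> ig; have := integrableZl measurableT a ig. Qed.

Lemma integrable_mul_square_integrable u v :
  square_integrable u -> square_integrable v ->
  P.-integrable [set: T] (EFin \o (fun x => u x * v x)).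
Proof.
move=> [mu iu] [mv iv]; apply: (le_integrable_real _ _ (integrable_realD iu iv)).
  exact: measurable_funM.
move=> x; rewrite ler_norml.
have := sqr_ge0 (u x - v x); have := sqr_ge0 (u x + v x).
have := sqr_ge0 (u x); have := sqr_ge0 (v x).
move: (u x) (v x) => a b *; apply/andP; split; lra.
Qed.

Lemma square_integrableD u v : square_integrable u -> square_integrable v ->
  square_integrable (fun x => u x + v x).
Proof.
move=> su sv; have [[mu iu] [mv iv]] := (su, sv); split.
  exact: measurable_funD.
have := integrable_realD (integrable_realD iu iv)
  (integrable_realZ 2 (integrable_mul_square_integrable su sv)).
by congr integrable; apply/funext => x /=; congr EFin; ring.
Qed.

Lemma square_integrableZ a u : square_integrable u ->
  square_integrable (fun x => a * u x).
Proof.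
move=> [mu iu]; split; first exact: measurable_funM.
have := integrable_realZ (a ^+ 2) iu.
by congr integrable; apply/funext => x /=; rewrite exprMn.
Qed.

Lemma square_integrableB u v : square_integrable u -> square_integrable v ->
  square_integrable (fun x => u x - v x).
Proof.
move=> su /(square_integrableZ (-1)) sv.
have := square_integrableD su sv.
by congr square_integrable; apply/funext => x; rewrite mulN1r.
Qed.

Lemma integrable_bounded (g : T -> R) C : measurable_fun [set: T] g ->
  (forall x, `|g x| <= C) -> P.-integrable [set: T] (EFin \o g).
Proof.
move=> mg gC; apply: (le_integrable_real mg gC).
exact: finite_measure_integrable_cst.
Qed.

Lemma square_integrable_bounded u C : measurable_fun [set: T] u ->
  (forall x, `|u x| <= C) -> square_integrable u.
Proof.
move=> mu uC; split=> //; apply: (@integrable_bounded _ (C ^+ 2)).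
  exact: measurable_funX.
move=> x; rewrite normrX ler_pXn2r ?nnegrE//.
by rewrite (le_trans _ (uC x)).
Qed.

Lemma sq_Rintegral_ge0 u : 0 <= \int[P]_x (u x ^+ 2).
Proof. by apply: Rintegral_ge0 => x _; exact: sqr_ge0. Qed.

Lemma sq_RintegralB u v : square_integrable u -> square_integrable v ->
  \int[P]_x ((u x - v x) ^+ 2) <=
  2 * \int[P]_x (u x ^+ 2) + 2 * \int[P]_x (v x ^+ 2).
Proof.
move=> su sv; have [iu iv] := (integrable_realZ 2 su.2, integrable_realZ 2 sv.2).
rewrite -(RintegralZl _ measurableT su.2) -(RintegralZl _ measurableT sv.2).
rewrite -(RintegralD measurableT iu iv); apply: le_Rintegral => //.
- by case: (square_integrableB su sv).
- exact: integrable_realD.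
- by move=> x _; have := sqr_ge0 (u x + v x); move: (u x) (v x) => a b; lra.
Qed.

Lemma EFin_sq_Rintegral u : square_integrable u ->
  (\int[P]_x (u x ^+ 2))%:E = (\int[P]_x ((u x ^+ 2)%:E))%E.
Proof. by move=> [mu iu]; rewrite /Rintegral fineK// integrable_fin_num. Qed.

Lemma square_integrable_lty u : measurable_fun [set: T] u ->
  (\int[P]_x (u x ^+ 2)%:E < +oo)%E -> square_integrable u.
Proof.
move=> mu iu; split => //; apply/integrableP; split.
  by apply/measurable_EFinP; exact: measurable_funX.
by under eq_integral do rewrite /= ger0_norm ?sqr_ge0//.
Qed.

(** A sequence that converges fast in the mean square converges almost
    everywhere: the sum of [|v k.+1 - v k|] has finite integral, because
    [2 |h| <= 2 ^- k + 2 ^+ k * h ^+ 2]. *)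
Lemma fast_cvg_ae (v : nat -> T -> R) : (forall k, square_integrable (v k)) ->
  (forall k, \int[P]_x ((v k.+1 x - v k x) ^+ 2) <= 4^-1 ^+ k) ->
  {ae P, forall x, cvgn (v ^~ x)}.
Proof.
move=> sv hv; pose h k x := `|v k.+1 x - v k x|.
have sB k : square_integrable (fun x => v k.+1 x - v k x).
  exact: square_integrableB.
have mh k : measurable_fun [set: T] (h k).
  by apply: measurableT_comp => //; case: (sB k).
have ih k : (\int[P]_x (h k x)%:E <= (4 / (2 ^ k.+1)%N%:R)%:E)%E.
  have i1 : P.-integrable [set: T] (EFin \o fun _ => (2 ^+ k)^-1 : R).
    exact: finite_measure_integrable_cst.
  have i2 := (sB k).2; have i3 := integrable_realZ (2 ^+ k) i2.
  have k0 : 0 < 2 ^+ k :> R by exact: exprn_gt0.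
  have ihk : P.-integrable [set: T] (EFin \o h k).
    apply: (le_integrable_real (mh k) _ (integrable_realD i1 i3)) => x.
    rewrite /h normr_id; move: (v k.+1 x - v k x) => b.
    rewrite -(real_normK (num_real b)); move: `|b| (normr_ge0 b) => c c0.
    have : 0 <= 2 ^+ k * ((2 ^+ k)^-1 - c) ^+ 2.
      by rewrite mulr_ge0 ?sqr_ge0// ltW.
    have -> : 2 ^+ k * ((2 ^+ k)^-1 - c) ^+ 2 =
      (2 ^+ k)^-1 + 2 ^+ k * c ^+ 2 - 2 * c by field; rewrite gt_eqF.
    lra.
  rewrite -[leLHS]fineK ?integrable_fin_num// lee_fin.
  apply: (@le_trans _ _ (\int[P]_x ((2 ^+ k)^-1 + 2 ^+ k * (v k.+1 x - v k x) ^+ 2))).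
    apply: le_Rintegral => //; first exact: integrable_realD.
    move=> x _; rewrite /h; move: (v k.+1 x - v k x) => b.
    rewrite -(real_normK (num_real b)); move: `|b| (normr_ge0 b) => c c0.
    have : 0 <= 2 ^+ k * ((2 ^+ k)^-1 - c) ^+ 2.
      by rewrite mulr_ge0 ?sqr_ge0// ltW.
    have -> : 2 ^+ k * ((2 ^+ k)^-1 - c) ^+ 2 =
      (2 ^+ k)^-1 + 2 ^+ k * c ^+ 2 - 2 * c by field; rewrite gt_eqF.
    lra.
  rewrite (RintegralD measurableT i1 i3) (RintegralZl _ measurableT i2).
  rewrite Rintegral_cst// fine_probability_setT mulr1.
  have := ler_wpM2l (ltW k0) (hv k).
  have -> : 2 ^+ k * 4^-1 ^+ k = (2 ^+ k)^-1 :> R.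
    rewrite -exprMn -[RHS]exprVn; congr (_ ^+ _); by field.
  rewrite natrX exprS invfM.
  lra.
have sumh : (\int[P]_x (\sum_(0 <= k <oo) (h k x)%:E) < +oo)%E.
  rewrite integral_nneseries//; last 2 first.
  - by move=> k; exact/measurable_EFinP.
  - by move=> n x _; rewrite lee_fin /h normr_ge0.
  rewrite (@le_lt_trans _ _ 4%:E) ?ltry//.
  apply: le_trans (epsilon_trick0 xpredT _) => //.
  apply: lee_nneseries => [k _ _|k _]; last exact: ih.
  by apply: integral_ge0 => x _; rewrite lee_fin /h normr_ge0.
have iS : P.-integrable [set: T] (fun x => \sum_(0 <= k <oo) (h k x)%:E)%E.
  apply/integrableP; split.
    apply: ge0_emeasurable_sum => [k x _ _|k _]; last exact/measurable_EFinP.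
    by rewrite lee_fin /h normr_ge0.
  have S0 x : (0 <= \sum_(0 <= k <oo) (h k x)%:E)%E.
    by apply: nneseries_ge0 => k _ _; rewrite lee_fin /h normr_ge0.
  under eq_integral => x _ do rewrite gee0_abs ?S0//.
  exact: sumh.
apply: filterS (integrable_ae measurableT iS) => x /(_ I) fin.
have : cvgn (series (fun k => v k.+1 x - v k x)).
  apply: normed_cvg; apply: nondecreasing_is_cvgn.
    by apply: nondecreasing_series => k _ _ /=.
  exists (fine (\sum_(0 <= k <oo) (h k x)%:E)%E) => _ [n _ <-].
  rewrite -lee_fin fineK// /series /= -sumEFin.
  exact: nneseries_lim_ge.
rewrite (_ : (fun k => v k.+1 x - v k x) = telescope (v ^~ x))// telescopeK.
move=> cv; rewrite (_ : v ^~ x = (fun n => (v n x - v 0%N x) + v 0%N x)).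
  by apply: is_cvgD => //; exact: is_cvg_cst.
by apply/funext => n; rewrite subrK.
Qed.

(** A subsequence that converges fast has a limit almost everywhere, and
    Fatou's lemma bounds the distance to it in the mean square. *)
Lemma square_integrable_complete (u : nat -> T -> R) :
  (forall n, square_integrable (u n)) ->
  (forall e : R, 0 < e -> exists n, forall i j, (n <= i)%N -> (n <= j)%N ->
     \int[P]_x ((u i x - u j x) ^+ 2) < e) ->
  exists2 w, square_integrable w & forall e : R, 0 < e ->
    exists n, forall i, (n <= i)%N -> \int[P]_x ((u i x - w x) ^+ 2) < e.
Proof.
move=> su cu.
have [n0 hn0] : {n0 : nat -> nat & forall k i j, (n0 k <= i)%N -> (n0 k <= j)%N ->
    \int[P]_x ((u i x - u j x) ^+ 2) < 4^-1 ^+ k}.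
  have c k : 0 < 4^-1 ^+ k :> R by exact: exprn_gt0.
  by exists (fun k => sval (cid (cu _ (c k)))) => k i j; case: cid => n; apply.
(* partial sums make the indices nondecreasing *)
pose m k := (\sum_(j < k.+1) n0 j)%N.
have mn k : (n0 k <= m k)%N by rewrite /m big_ord_recr leq_addl.
have mm k i : (k <= i)%N -> (m k <= m i)%N.
  move=> /subnK <-; elim: (i - k)%N => // l IH.
  by rewrite (leq_trans IH)// addSn /m [X in (_ <= X)%N]big_ord_recr leq_addr.
pose v k := u (m k).
have sv k : square_integrable (v k) by exact: su.
have vfast k i : (k <= i)%N -> \int[P]_x ((v i x - v k x) ^+ 2) <= 4^-1 ^+ k.
  move=> ki; apply/ltW/hn0; last exact: mn.
  by rewrite (leq_trans (mn k))// mm.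
have cvgv := fast_cvg_ae sv (fun k => vfast k k.+1 (leqnSn k)).
(* the upper limit is measurable, and it is the limit wherever there is one *)
pose w x := fine (limn_esup (fun k => (v k x)%:E)).
have mw : measurable_fun [set: T] w.
  apply: (measurableT_comp (f := fine)) => //.
  by apply: measurable_fun_limn_esup => k; apply/measurable_EFinP; case: (sv k).
have vw : {ae P, forall x, v ^~ x @ \oo --> w x}.
  apply: filterS cvgv => x cx; rewrite /w.
  have cE : (fun k => (v k x)%:E) @ \oo --> (limn (v ^~ x))%:E.
    by apply: cvg_EFin => //; near=> j.
  by rewrite is_cvg_limn_esupE; [rewrite (cvg_lim _ cE)|exact: cvgP cE].
have wv k : (\int[P]_x ((w x - v k x) ^+ 2)%:E <= (4^-1 ^+ k)%:E)%E.
  have mf j : measurable_fun [set: T] (fun x => ((v j x - v k x) ^+ 2)%:E).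
    apply/measurable_EFinP/measurable_funX/measurable_funB.
      by case: (sv j).
    by case: (sv k).
  have f0 j x : [set: T] x -> (0 <= ((v j x - v k x) ^+ 2)%:E)%E.
    by rewrite lee_fin sqr_ge0.
  have -> : (\int[P]_x ((w x - v k x) ^+ 2)%:E =
      \int[P]_x limn_einf (fun j => ((v j x - v k x) ^+ 2)%:E))%E.
    apply: ae_eq_integral => //.
    - apply/measurable_EFinP/measurable_funX/measurable_funB => //.
      by case: (sv k).
    - rewrite /limn_einf; apply: measurableT_comp => //.
      by apply: measurable_fun_limn_esup => j; exact: measurableT_comp.
    - apply: filterS vw => x vx _.
      have cE : (fun j => ((v j x - v k x) ^+ 2)%:E) @ \oo --> ((w x - v k x) ^+ 2)%:E.
        apply: cvg_EFin; first by near=> j.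
        by apply: cvgM; (apply: cvgB; [exact: vx|exact: cvg_cst]).
      by rewrite is_cvg_limn_einfE; [rewrite (cvg_lim _ cE)|exact: cvgP cE].
  apply: (le_trans (fatou _ measurableT mf f0)).
  rewrite limn_einf_lim; apply: lime_le; first exact: is_cvg_einfs.
  near=> j; have kj : (k <= j)%N by near: j; exact: nbhs_infty_ge.
  apply: (@le_trans _ _ (\int[P]_x ((v j x - v k x) ^+ 2)%:E)%E).
    by apply: ereal_inf_lbound; exists j => /=.
  by rewrite -EFin_sq_Rintegral ?lee_fin ?vfast//; exact: square_integrableB.
have swv k : square_integrable (fun x => w x - v k x).
  apply: square_integrable_lty; last exact: le_lt_trans (wv k) (ltry _).
  by apply: measurable_funB => //; case: (sv k).
exists w.
  have := square_integrableD (swv 0%N) (sv 0%N).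
  by congr square_integrable; apply/funext => x; rewrite subrK.
move=> e e0.
have [k k4] : exists k, 4^-1 ^+ k < e / 4.
  have e4 : 0 < e / 4 by rewrite divr_gt0.
  have : (fun k => 4^-1 ^+ k : R) @ \oo --> 0.
    by apply: cvg_expr; rewrite ger0_norm// invf_lt1// ltr1n.
  move=> /cvgrPdist_lt/(_ _ e4)[k _ /(_ k (leqnn k))].
  by rewrite sub0r normrN ger0_norm ?exprn_ge0//; exists k.
exists (n0 k) => i ni.
have h1 : \int[P]_x ((u i x - v k x) ^+ 2) < 4^-1 ^+ k by apply: hn0 => //; exact: mn.
have h2 : \int[P]_x ((w x - v k x) ^+ 2) <= 4^-1 ^+ k.
  by rewrite -lee_fin EFin_sq_Rintegral//.
have := sq_RintegralB (square_integrableB (su i) (sv k)) (swv k).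
rewrite (_ : \int[P]_x _ = \int[P]_x ((u i x - w x) ^+ 2)); last first.
  by apply: eq_Rintegral => x _; rewrite opprB addrA subrK.
by move=> /le_lt_trans; apply; lra.
Unshelve. all: by end_near. Qed.
End SquareIntegrable.

(** * The complex space L2 *)

Section L2Space.
Context d (T : measurableType d) (R : realType) (P : probability T R).
Implicit Types f g : T -> R[i].

Lemma L2norm_sq f :
  (L2norm P f `^ 2 =
   \int[P]_x (complex.Re (f x) ^+ 2 + complex.Im (f x) ^+ 2)%:E)%E.
Proof.
rewrite /L2norm powR_Lnorm ?pnatr_eq0//; apply: eq_integral => x _ /=.
case: (f x) => a b /=.
rewrite powR_mulrn ?normr_ge0// real_normK ?num_real//.
by rewrite sqr_sqrtr// addr_ge0 ?sqr_ge0.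
Qed.

Lemma in_L2P f : in_L2 P f <->
  square_integrable P (@complex.Re R \o f) /\ square_integrable P (@complex.Im R \o f).
Proof.
split=> [[mRe mIm fin]|[[mRe iRe] [mIm iIm]]].
  have fin2 : (\int[P]_x (complex.Re (f x) ^+ 2 + complex.Im (f x) ^+ 2)%:E < +oo)%E.
    by rewrite -L2norm_sq poweR_lty.
  have mS : measurable_fun [set: T]
      (fun x => (complex.Re (f x) ^+ 2 + complex.Im (f x) ^+ 2)%:E).
    by apply/measurable_EFinP/measurable_funD; exact: measurable_funX.
  split; apply: square_integrable_lty => //; apply: le_lt_trans fin2;
    (apply: ge0_le_integral => //; [by move=> x _; rewrite lee_fin sqr_ge0
      |exact/measurable_EFinP/measurable_funX|]) => x _;
    by rewrite lee_fin /= ?lerDl ?lerDr sqr_ge0.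
split=> //; rewrite (@lty_poweRy _ _ 2)// L2norm_sq.
exact: (integrable_lty measurableT (integrable_realD iRe iIm)).
Qed.

Lemma L2norm_real f : in_L2 P f -> exists2 r : R, 0 <= r &
  L2norm P f = r%:E /\ r ^+ 2 = \int[P]_x (complex.Re (f x) ^+ 2) +
                                \int[P]_x (complex.Im (f x) ^+ 2).
Proof.
move=> Lf; have /in_L2P[[mRe iRe] [mIm iIm]] := Lf; case: Lf => _ _ fin.
have L0 : (0 <= L2norm P f)%E by exact: Lnorm_ge0.
have rE : L2norm P f = (fine (L2norm P f))%:E by rewrite fineK// ge0_fin_numE.
exists (fine (L2norm P f)); first exact: fine_ge0.
split=> //; have := L2norm_sq f; rewrite rE poweR_EFin /= powR_mulrn ?fine_ge0//.
rewrite -(RintegralD measurableT iRe iIm) => h.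
by rewrite /Rintegral -h.
Qed.

Lemma square_integrable0 : square_integrable P (fun=> 0).
Proof.
by apply: (@square_integrable_bounded _ _ _ _ _ 0) => // x; rewrite normr0.
Qed.

Definition L2_pred : {pred T -> R[i]} := [pred f | `[< in_L2 P f >]].

Lemma L2_predP f : reflect (in_L2 P f) (f \in L2_pred).
Proof. exact: asboolP. Qed.

Lemma L2_submod_closed : submod_closed L2_pred.
Proof.
split.
  by apply/L2_predP/in_L2P; split; exact: square_integrable0.
move=> a f g; move=> /L2_predP/in_L2P[fR fI] /L2_predP/in_L2P[gR gI].
apply/L2_predP/in_L2P; case: a => a b; split.
- have := square_integrableD (square_integrableB (square_integrableZ a fR)
    (square_integrableZ b fI)) gR.
  congr square_integrable; apply/funext => x /=; rewrite !fctE.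
  by case: (f x) (g x) => [? ?] [? ?].
- have := square_integrableD (square_integrableD (square_integrableZ a fI)
    (square_integrableZ b fR)) gI.
  congr square_integrable; apply/funext => x /=; rewrite !fctE.
  by case: (f x) (g x) => [? ?] [? ?].
Qed.

HB.instance Definition _ :=
  GRing.isSubmodClosed.Build R[i] (T -> R[i]) L2_pred L2_submod_closed.

(** Functions that agree almost everywhere are not identified; they are at
    distance zero. *)
Record L2 := MkL2 { L2_fun :> T -> R[i]; L2_funP : L2_fun \in L2_pred }.
HB.instance Definition _ := [isSub for L2_fun].
HB.instance Definition _ := [Choice of L2 by <:].
HB.instance Definition _ := [SubChoice_isSubLmodule of L2 by <:].

Lemma L2_in (f : L2) : in_L2 P f.
Proof. exact/L2_predP/L2_funP. Qed.

Definition L2_of f (h : in_L2 P f) : L2 := MkL2 (introT (L2_predP _) h).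

Definition L2ip (f g : L2) : R[i] := inner P f g.

Lemma L2_addE (f g : L2) x : (f + g : L2) x = f x + g x. Proof. by []. Qed.
Lemma L2_scaleE a (f : L2) x : (a *: f : L2) x = a * f x. Proof. by []. Qed.
Lemma L2_subE (f g : L2) x : (f - g : L2) x = f x - g x. Proof. by []. Qed.

Let ReM (a b : R[i]) : complex.Re (a * conjc b) =
  complex.Re a * complex.Re b + complex.Im a * complex.Im b.
Proof. by case: a b => [? ?] [? ?] /=; ring. Qed.

Let ImM (a b : R[i]) : complex.Im (a * conjc b) =
  complex.Im a * complex.Re b - complex.Re a * complex.Im b.
Proof. by case: a b => [? ?] [? ?] /=; ring. Qed.

Lemma integrable_Re (f g : L2) :
  P.-integrable [set: T] (EFin \o (fun x => complex.Re (f x * conjc (g x)))).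
Proof.
have [/in_L2P[fR fI] /in_L2P[gR gI]] := (L2_in f, L2_in g).
have := integrable_realD (integrable_mul_square_integrable fR gR)
  (integrable_mul_square_integrable fI gI).
by congr integrable; apply/funext => x /=; rewrite -ReM.
Qed.

Lemma integrable_Im (f g : L2) :
  P.-integrable [set: T] (EFin \o (fun x => complex.Im (f x * conjc (g x)))).
Proof.
have [/in_L2P[fR fI] /in_L2P[gR gI]] := (L2_in f, L2_in g).
have := integrable_realD (integrable_mul_square_integrable fI gR)
  (integrable_realZ (-1) (integrable_mul_square_integrable fR gI)).
by congr integrable; apply/funext => x /=; rewrite ImM mulN1r.
Qed.

Lemma L2ip_semi_inner_product : semi_inner_product L2ip.
Proof.
split.
- move=> f g h; rewrite /L2ip /inner /cintegral.
  rewrite -[RHS]/(_ +i* _); congr (_ +i* _).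
    rewrite -(RintegralD measurableT (integrable_Re f h) (integrable_Re g h)).
    by apply: eq_Rintegral => x _; rewrite L2_addE mulrDl raddfD.
  rewrite -(RintegralD measurableT (integrable_Im f h) (integrable_Im g h)).
  by apply: eq_Rintegral => x _; rewrite L2_addE mulrDl raddfD.
- move=> [a b] f g; rewrite /L2ip /inner /cintegral.
  have [iR iI] := (integrable_Re f g, integrable_Im f g).
  rewrite -[RHS]/(_ +i* _); congr (_ +i* _).
    rewrite -(RintegralZl _ measurableT iR) -(RintegralZl _ measurableT iI).
    rewrite -(RintegralB measurableT (integrable_realZ a iR) (integrable_realZ b iI)).
    apply: eq_Rintegral => x _; rewrite L2_scaleE -mulrA.
    by case: (_ * conjc _).
  rewrite -(RintegralZl _ measurableT iR) -(RintegralZl _ measurableT iI).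
  rewrite -(RintegralD measurableT (integrable_realZ a iI) (integrable_realZ b iR)).
  apply: eq_Rintegral => x _; rewrite L2_scaleE -mulrA.
  by case: (_ * conjc _).
- move=> f g; rewrite /L2ip /inner /cintegral /=; congr (_ +i* _).
    by apply: eq_Rintegral => x _; rewrite !ReM mulrC [X in _ + X]mulrC.
  rewrite -mulN1r -(RintegralZl _ measurableT (integrable_Im f g)).
  by apply: eq_Rintegral => x _; rewrite !ImM; ring.
- move=> f; rewrite /L2ip /inner /cintegral /=; apply: Rintegral_ge0 => x _.
  by rewrite ReM -!expr2 addr_ge0 ?sqr_ge0.
Qed.

Lemma L2_sqnormE (f : L2) : sqnorm L2ip f =
  \int[P]_x (complex.Re (f x) ^+ 2) + \int[P]_x (complex.Im (f x) ^+ 2).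
Proof.
have /in_L2P[[_ fR] [_ fI]] := L2_in f.
rewrite -(RintegralD measurableT fR fI) /sqnorm /L2ip /inner /cintegral /=.
by apply: eq_Rintegral => x _; rewrite ReM -!expr2.
Qed.

Lemma L2norm_lt (f : L2) (e : R) : 0 < e ->
  (L2norm P f < e%:E)%E <-> sqnorm L2ip f < e ^+ 2.
Proof.
move=> e0; have [r r0 [-> rE]] := L2norm_real (L2_in f).
by rewrite L2_sqnormE -rE lte_fin ltr_pXn2r// nnegrE// ltW.
Qed.

Lemma L2_complete : complete_sqnorm L2ip.
Proof.
move=> u cu.
have sR n : square_integrable P (fun x => complex.Re (u n x)).
  by have /in_L2P[] := L2_in (u n).
have sI n : square_integrable P (fun x => complex.Im (u n x)).
  by have /in_L2P[] := L2_in (u n).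
have splitN (f g : L2) : sqnorm L2ip (f - g) =
    \int[P]_x ((complex.Re (f x) - complex.Re (g x)) ^+ 2) +
    \int[P]_x ((complex.Im (f x) - complex.Im (g x)) ^+ 2).
  rewrite L2_sqnormE; congr (_ + _); apply: eq_Rintegral => x _;
    by rewrite L2_subE raddfB.
have [|a sa ca] := square_integrable_complete sR.
  move=> e /cu[n hn]; exists n => i j ni nj.
  rewrite (le_lt_trans _ (hn i j ni nj))// splitN lerDl.
  exact: sq_Rintegral_ge0.
have [|b sb cb] := square_integrable_complete sI.
  move=> e /cu[n hn]; exists n => i j ni nj.
  rewrite (le_lt_trans _ (hn i j ni nj))// splitN lerDr.
  exact: sq_Rintegral_ge0.
have Lw : in_L2 P (fun x => a x +i* b x) by apply/in_L2P.
exists (L2_of Lw) => e e0; have e2 : 0 < e / 2 by rewrite divr_gt0.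
have [n hn] := ca _ e2; have [k hk] := cb _ e2.
exists (maxn n k) => i; rewrite geq_max => /andP[ni ki].
by rewrite splitN [ltRHS]splitr ltrD ?hn ?hk.
Qed.

End L2Space.

(** * The Koopman representation *)

Section KoopmanRepresentation.
Context (R : realType) (G : topologicalZmodType) (X : pmetricType R).
Context (act : G -> X -> X) (m : probability (borel X) R).
Hypotheses (hact : continuous_action act) (hm : invariant_measure act m).

Lemma open_borel (A : set X) : open A -> measurable (A : set (borel X)).
Proof. by move=> oA; exact: sub_sigma_algebra. Qed.

Lemma continuous_borel_real (f : X -> R) : continuous f ->
  measurable_fun [set: borel X] (f : borel X -> R).
Proof.
move=> cf; apply: (measurability _ (RGenOpens.measurableE R)).
move=> _ [_ [a [b ->] <-]]; rewrite setTI; apply: open_borel.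
by apply: open_comp => [x _|]; [exact: cf|exact: interval_open].
Qed.

Lemma continuous_act t : continuous (act t).
Proof.
case: hact => _ _ cact x.
have := cact (t, x); apply: (@cvg_comp _ _ _ (fun y => (t, y)) (fun p : G * X => act p.1 p.2)).
by apply: cvg_pair => /=; [exact: cvg_cst|exact: cvg_id].
Qed.

Lemma measurable_act t :
  measurable_fun [set: borel X] (act t : borel X -> borel X).
Proof.
apply: (@measurability _ _ (borel X) (borel X) _ _ (@open X) erefl).
move=> _ [A oA <-]; rewrite setTI; apply: open_borel.
by apply: open_comp => // x _; exact: continuous_act.
Qed.

Lemma ge0_integral_act t (h : borel X -> \bar R) :
  measurable_fun [set: borel X] h -> (forall x, (0 <= h x)%E) ->
  (\int[m]_x h (act t x) = \int[m]_x h x)%E.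
Proof.
move=> mh h0.
have := ge0_integral_pushforward (measurable_act t) m measurableT mh
  (fun x _ => h0 x).
rewrite preimage_setT => <-; apply: eq_measure_integral => [|mf A mA _].
  exact: measurable_act.
exact: hm.
Qed.

Lemma integrable_act t (h : borel X -> R) :
  m.-integrable [set: borel X] (EFin \o h) ->
  m.-integrable [set: borel X] (EFin \o (fun x => h (act t x))).
Proof.
move=> /integrableP[mh ih]; apply/integrableP; split.
  exact: (measurableT_comp mh (measurable_act t)).
rewrite (ge0_integral_act t (h := fun x => `|(h x)%:E|%E))//.
exact: measurableT_comp.
Qed.

Lemma Rintegral_act t (h : borel X -> R) :
  m.-integrable [set: borel X] (EFin \o h) ->
  \int[m]_x h (act t x) = \int[m]_x h x.
Proof.
move=> ih; rewrite /Rintegral; congr fine.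
have := integral_pushforward (measurable_act t) (measurable_int m ih)
  (D := setT) (integrable_act t ih) measurableT.
rewrite preimage_setT => <-; apply: eq_measure_integral => [|mf A mA _].
  exact: measurable_act.
exact: hm.
Qed.

Lemma square_integrable_act t u : square_integrable m u ->
  square_integrable m (fun x => u (act t x)).
Proof.
move=> [mu iu]; split; first exact: (measurableT_comp mu (measurable_act t)).
exact: (integrable_act t iu).
Qed.

Lemma koopman_in_L2 t (f : L2 m) : in_L2 m (koopman act t f).
Proof.
have /in_L2P[sR sI] := L2_in f; apply/in_L2P; split;
  [exact: (square_integrable_act t sR)|exact: (square_integrable_act t sI)].
Qed.

Definition koopmanL2 t (f : L2 m) : L2 m := L2_of (koopman_in_L2 t f).

Lemma koopman_representation : isometric_representation (@L2ip _ _ _ m) koopmanL2.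
Proof.
case: hact => act0 actD _; split.
- by move=> t f g; exact/val_inj.
- by move=> t a f; exact/val_inj.
- by move=> f; apply/val_inj/funext => x /=; rewrite /koopman act0.
- move=> s t f; apply/val_inj/funext => x /=; rewrite /koopman addrC actD.
  by [].
- move=> t f g; rewrite /L2ip /inner /cintegral /=; congr (_ +i* _).
    exact: (Rintegral_act t (integrable_Re f g)).
  exact: (Rintegral_act t (integrable_Im f g)).
Qed.

End KoopmanRepresentation.

(** * Almost periodic vectors with continuous orbits *)

Lemma compact_translates (G : topologicalZmodType) (K W : set G) :
  compact K -> nbhs (0 : G) W ->
  exists r : seq G, forall y, K y -> exists2 k, k \in r & W (y - k).
Proof.
move=> /compact_near_coveringP cK W0.
(* finite families of translates, directed by inclusion *)
pose F : set_system (seq G) :=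
  [set S | exists r0 : seq G, forall r : seq G, {subset r0 <= r} -> S r].
have FF : Filter F.
  split; first by exists [::].
  - move=> S S' [r0 h] [r0' h']; exists (r0 ++ r0') => r sub; split.
      by apply: h => x xr; apply: sub; rewrite mem_cat xr.
    by apply: h' => x xr; apply: sub; rewrite mem_cat xr orbT.
  - by move=> S S' SS' [r0 h]; exists r0 => r /h/SS'.
pose P (r : seq G) y := exists2 k, k \in r & W (y - k).
have [r0 /(_ r0 (fun _ => id)) r0P] : F [set r | K `<=` P r].
  apply: (cK _ F P FF) => x Kx.
  exists ([set y | W (y - x)], [set r : seq G | x \in r]) => /=; last first.
    by move=> [y r] /= [Wyx xr]; exists x.
  split; last by exists [:: x] => r; apply; exact: mem_head.
  have c : (y - x) @[y --> x] --> (0 : G).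
    rewrite -(subrr x); have := @sub_continuous G (x, x).
    apply: (@cvg_comp _ _ _ (fun y => (y, x)) (fun p : G * G => p.1 - p.2)).
    by apply: cvg_pair => /=; [exact: cvg_id|exact: cvg_cst].
  exact: c.
by exists r0.
Qed.

Section RegularVectors.
Context (R : realType) (V : lmodType R[i]) (ip : V -> V -> R[i]).
Context (ipP : semi_inner_product ip).
Context (G : topologicalZmodType) (U : G -> V -> V).
Context (UP : isometric_representation ip U).
Local Notation N := (sqnorm ip).

Definition continuous_orbit x := forall e : R, 0 < e ->
  \forall t \near (0 : G), N (U t x - x) < e.

(** Total boundedness yields eigenvectors and continuity makes their
    eigenvalues continuous; both are propagated through L2 by the same
    approximations. *)
Definition regular_orbit x := totally_bounded_orbit ip U x /\ continuous_orbit x.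

Lemma regular_orbit_limit x :
  (forall e : R, 0 < e -> exists2 y, regular_orbit y & N (x - y) < e) ->
  regular_orbit x.
Proof.
move=> h; split.
  apply: (totally_bounded_orbit_limit ipP UP) => e /h[y [tby _] xy].
  by exists y.
move=> e e0; have e12 : 0 < e / 12 by rewrite divr_gt0.
have [y [_ cy] xy] := h _ e12; apply: filterS (cy _ e12) => t ty.
have := sqnormB ipP (U t x) x (U t y); have := sqnormB ipP (U t y) x y.
rewrite -(repB UP) (rep_sqnorm UP) (sqnormBC ipP y).
move: (N _) (N _) (N _) (N _) xy ty => A B C D; lra.
Qed.

Lemma regular_orbitD x y : regular_orbit x -> regular_orbit y ->
  regular_orbit (x + y).
Proof.
move=> [tbx cx] [tby cy]; split; first exact: (totally_bounded_orbitD ipP UP).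
move=> e e0; have e4 : 0 < e / 4 by rewrite divr_gt0.
apply: filterS2 (cx _ e4) (cy _ e4) => t xt yt.
rewrite (repD UP) opprD addrACA.
rewrite (le_lt_trans (sqnormD ipP _ _))//; lra.
Qed.

Lemma regular_orbitZ a x : regular_orbit x -> regular_orbit (a *: x).
Proof.
move=> [tbx cx]; split; first exact: (totally_bounded_orbitZ ipP UP).
move=> e e0; have a1 : 0 < normc2 a + 1 by rewrite ltr_wpDl ?normc2_ge0.
apply: filterS (cx _ (divr_gt0 e0 a1)) => t xt.
rewrite (repZ UP) -scalerBr (sqnormZ ipP).
move: xt; rewrite ltr_pdivlMr//; have := sqnorm_ge0 ipP (U t x - x); lra.
Qed.

Lemma totally_bounded_orbit_net x :
  (forall e : R, 0 < e -> exists r : seq G,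
     forall s, exists2 k, k \in r & N (U s x - U k x) < e) ->
  totally_bounded_orbit ip U x.
Proof.
move=> h e e0; have e4 : 0 < e / 4 by rewrite divr_gt0.
have [r hr] := h _ e4.
have [k hk] : {k : G -> G & forall s, k s \in r /\ N (U s x - U (k s) x) < e / 4}.
  exists (fun s => sval (cid2 (hr s))) => s.
  by case: cid2.
have kr s : (index (k s) r < (size r).+1)%N by rewrite ltnS index_size.
exists 'I_(size r).+1, (fun s => Ordinal (kr s)) => s t /(congr1 val) /= st.
have kst : k s = k t.
  by rewrite -(nth_index 0 (hk s).1) -(nth_index 0 (hk t).1) st.
have := sqnormB ipP (U s x) (U t x) (U (k s) x).
have := (hk s).2; have := (hk t).2.
rewrite -kst (sqnormBC ipP (U t x)); lra.
Qed.

(** If returns to the neighbourhoods of [x] are relatively dense, then the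
    orbit is covered by the translates by a compact set, hence by finitely
    many small sets. *)
Lemma regular_orbit_of_returns x : continuous_orbit x ->
  (forall e : R, 0 < e -> relatively_dense [set t | N (U t x - x) < e]) ->
  regular_orbit x.
Proof.
move=> cx h; split => //; apply: totally_bounded_orbit_net => e e0.
have e4 : 0 < e / 4 by rewrite divr_gt0.
have [K cK AK] := h _ e4.
have [r hr] := compact_translates cK (cx _ e4).
exists r => s; have : [set: G] s by [].
rewrite -AK => -[a /= ax [k Kk <-]].
have [j jr kj] := hr _ Kk; exists j => //.
have := sqnormB ipP (U (a + k) x) (U j x) (U k x).
rewrite !(sqnorm_rep_diff UP) addrK; lra.
Qed.

End RegularVectors.

(** * Almost periodicity of square integrable functions *)

Lemma square_integrable_dominated_convergence d (T : measurableType d)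
    (R : realType) (P : probability T R) (u_ : nat -> T -> R) (u h : T -> R) :
  (forall n, measurable_fun [set: T] (u_ n)) -> measurable_fun [set: T] u ->
  (forall x, u_ ^~ x @ \oo --> u x) ->
  (forall n x, (u x - u_ n x) ^+ 2 <= h x) ->
  P.-integrable [set: T] (EFin \o h) ->
  forall e : R, 0 < e -> exists n, \int[P]_x ((u x - u_ n x) ^+ 2) < e.
Proof.
move=> mu_ mu cu uh ih e e0.
pose f n x := ((u x - u_ n x) ^+ 2)%:E.
have mf n : measurable_fun [set: T] (f n).
  by apply/measurable_EFinP/measurable_funX/measurable_funB.
have f0 : {ae P, forall x, [set: T] x -> f ^~ x @ \oo --> (0 : \bar R)}.
  apply: nearW => x _; apply: cvg_EFin; first by near=> n.
  rewrite (_ : 0 = (u x - u x) * (u x - u x)); last by rewrite subrr mulr0.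
  by apply: cvgM; (apply: cvgB; [exact: cvg_cst|exact: cu]).
have fh : {ae P, forall x n, [set: T] x -> (`|f n x| <= (EFin \o h) x)%E}.
  by apply: nearW => x n _; rewrite /f /= ger0_norm ?sqr_ge0// lee_fin.
have [_ _] := dominated_convergence measurableT mf (measurable_cst 0%E) f0 ih fh.
rewrite integral0 => /fine_cvgP[_ /cvgrPdist_lt/(_ _ e0)[n _ /(_ n (leqnn n))]].
rewrite /= sub0r normrN => hn; exists n.
by rewrite (le_lt_trans _ hn)// ler_norm.
Unshelve. all: by end_near. Qed.

Section RegularFunctions.
Context (R : realType) (G : topologicalZmodType) (X : pmetricType R).
Context (act : G -> X -> X) (m : probability (borel X) R).
Hypotheses (hact : continuous_action act) (hm : invariant_measure act m).
Local Notation ip := (@L2ip _ _ _ m).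
Local Notation U := (koopmanL2 hact hm).
Local Notation N := (sqnorm ip).
Let ipP : semi_inner_product ip := L2ip_semi_inner_product m.
Let UP : isometric_representation ip U := koopman_representation hact hm.

Lemma in_L2_real (u : borel X -> R) : square_integrable m u ->
  in_L2 m (fun x => (u x)%:C).
Proof. by move=> su; apply/in_L2P; split=> //; exact: square_integrable0. Qed.

Definition realL2 u (su : square_integrable m u) : L2 m :=
  L2_of (in_L2_real su).

Lemma realL2_sqnormB u v (su : square_integrable m u) (sv : square_integrable m v) :
  N (realL2 su - realL2 sv) = \int[m]_x ((u x - v x) ^+ 2).
Proof.
rewrite L2_sqnormE [X in _ + X](_ : _ = 0) ?addr0.
  by apply: eq_Rintegral.
transitivity (\int[m]_(_ in [set: borel X]) (0 : R)).
  by apply: eq_Rintegral => x _ /=; rewrite subr0 expr0n.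
by rewrite Rintegral_cst// mul0r.
Qed.

Definition regular_real (u : borel X -> R) :=
  exists su : square_integrable m u, regular_orbit ip U (realL2 su).

Lemma regular_real_limit u : square_integrable m u ->
  (forall e : R, 0 < e ->
    exists2 v, regular_real v & \int[m]_x ((u x - v x) ^+ 2) < e) ->
  regular_real u.
Proof.
move=> su h; exists su; apply: (regular_orbit_limit ipP UP) => e /h[v [sv rv] uv].
by exists (realL2 sv) => //; rewrite realL2_sqnormB.
Qed.

Lemma regular_real_lincomb a b u v : regular_real u -> regular_real v ->
  regular_real (fun x => a * u x + b * v x).
Proof.
move=> [su ru] [sv rv].
exists (square_integrableD (square_integrableZ a su) (square_integrableZ b sv)).
set w := realL2 _.
have -> : w = a%:C *: realL2 su + b%:C *: realL2 sv.
  apply/val_inj/funext => x /=; apply/eqP; rewrite eq_complex /=.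
  by rewrite !mul0r !mulr0 !subr0 !addr0 !eqxx.
by apply: (regular_orbitD ipP UP); exact: (regular_orbitZ ipP UP).
Qed.

Lemma eq_regular_real u v : u =1 v -> regular_real u -> regular_real v.
Proof. by move=> /funext ->. Qed.

Section Lipschitz.
Variables (u : X -> R) (L C : R).
Hypotheses (L0 : 0 <= L) (uL : forall x y, `|u x - u y| <= L * mdist x y).
Hypothesis uC : forall x, `|u x| <= C.

Lemma continuous_lipschitz : continuous u.
Proof.
move=> x; apply/cvgrPdist_lt => e e0.
have L1 : 0 < L + 1 by rewrite ltr_wpDl.
have : nbhs x (ball x (e / (L + 1))) by apply: nbhsx_ballx; rewrite divr_gt0.
rewrite ballEmdist; apply: filterS => y /= xy.
rewrite (le_lt_trans (uL x y))// (@le_lt_trans _ _ ((L + 1) * mdist x y))//.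
  by rewrite ler_wpM2r ?mdist_ge0// lerDl.
by rewrite mulrC -ltr_pdivlMr.
Qed.

Lemma square_integrable_lipschitz : square_integrable m u.
Proof.
apply: (@square_integrable_bounded _ (borel X) R m u C) => //.
by apply: continuous_borel_real; exact: continuous_lipschitz.
Qed.
End Lipschitz.

Lemma mdist_lipschitz (x y z : X) : `|mdist x y - mdist x z| <= mdist y z.
Proof.
rewrite ler_norml; have := metric_triangle x y z; have := metric_triangle x z y.
by rewrite (metric_sym z y) => *; apply/andP; split; lra.
Qed.

Lemma open_displacement t (e : R) : open [set x | e < mdist x (act t x)].
Proof.
rewrite openE => x /= ex; pose r := (mdist x (act t x) - e) / 2.
have r0 : 0 < r by rewrite divr_gt0// subr_gt0.
have b1 : nbhs x (ball x r) by exact: nbhsx_ballx.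
have b2 : nbhs x (act t @^-1` ball (act t x) r).
  have c := @continuous_act _ _ _ _ hact t x.
  by apply: c; exact: nbhsx_ballx.
apply: filterS2 b1 b2; rewrite !ballEmdist => y /= xy txy.
have := mdist_lipschitz (act t x) x y.
have := mdist_lipschitz y (act t x) (act t y).
rewrite (metric_sym (act t x) x) (metric_sym (act t x) y) !ler_norml.
move=> /andP[_ ?] /andP[_ ?]; have : r * 2 = mdist x (act t x) - e by rewrite mulfVK.
lra.
Qed.

(** Off the exceptional set, [u] changes by at most [L * eps]; on that set,
    whose measure is below [eps], by at most [2 * C]. *)
Lemma almost_period_return u L C (eps : R) t : 0 <= L ->
  (forall x y, `|u x - u y| <= L * mdist x y) -> (forall x, `|u x| <= C) ->
  0 < eps -> almost_period act m (@mdist R X) eps t ->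
  \int[m]_x ((u (act t x) - u x) ^+ 2) <= L ^+ 2 * eps ^+ 2 + 4 * C ^+ 2 * eps.
Proof.
move=> L0 uL uC eps0 tA.
have su := square_integrable_lipschitz L0 uL uC.
pose A : set (borel X) := [set x | eps < mdist x (act t x)].
have mA : measurable A by apply: open_borel; exact: open_displacement.
have iA : m.-integrable [set: borel X] (EFin \o (\1_A : borel X -> R)).
  apply: (@integrable_bounded _ _ _ _ _ 1) => [|x]; first exact: measurable_indic.
  by rewrite indicE; case: (_ \in _); rewrite ?normr1 ?normr0.
have C4 : 0 <= 4 * C ^+ 2 by rewrite pmulr_rge0 ?sqr_ge0.
have iA' := integrable_realZ (4 * C ^+ 2) iA.
have ic : m.-integrable [set: borel X] (EFin \o fun=> L ^+ 2 * eps ^+ 2).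
  exact: finite_measure_integrable_cst.
apply: (@le_trans _ _ (\int[m]_x (L ^+ 2 * eps ^+ 2 + 4 * C ^+ 2 * \1_A x))).
  apply: le_Rintegral => //.
  - by case: (square_integrableB (square_integrable_act hact hm t su) su).
  - exact: integrable_realD.
  - move=> x _; rewrite indicE.
    have [xA|] := boolP (x \in A); last first.
      rewrite notin_setE /A /= => /negP; rewrite -leNgt => xA.
      rewrite mulr0 addr0 -exprMn -(real_normK (num_real _)).
      rewrite ler_pXn2r ?nnegrE ?mulr_ge0 ?(ltW eps0)//.
      by rewrite distrC (le_trans (uL _ _))// ler_wpM2l.
    rewrite mulr1; have h1 := uC (act t x); have h2 := uC x.
    have : (u (act t x) - u x) ^+ 2 <= (2 * C) ^+ 2.
      have C0 : 0 <= C by exact: (le_trans (normr_ge0 _) h1).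
      rewrite -(real_normK (num_real _)) ler_pXn2r ?nnegrE ?mulr_ge0//.
      by rewrite (le_trans (ler_normB _ _))// mulr_natl mulr2n lerD.
    rewrite exprMn => /le_trans; apply.
    by rewrite -[2 ^+ 2]/(2 * 2) -natrM lerDr mulr_ge0// sqr_ge0.
rewrite (RintegralD measurableT ic iA') (RintegralZl _ measurableT iA).
rewrite Rintegral_cst// fine_probability_setT mulr1 lerD2l.
rewrite ler_wpM2l//.
have -> : \int[m]_x (\1_A x : R) = fine (m A).
  rewrite /Rintegral; congr fine.
  by have := integral_indic m measurableT mA; rewrite setIT.
rewrite -lee_fin fineK; first exact: ltW tA.
by rewrite ge0_fin_numE// (lt_trans tA)// ltry.
Qed.

Hypothesis hX : compact [set: X].

(** By compactness of [X], elements close to 0 move all points by little, so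
    that the exceptional set is empty. *)
Lemma near_almost_period (e : R) : 0 < e ->
  \forall t \near (0 : G), almost_period act m (@mdist R X) e t.
Proof.
move=> e0; have e2 : 0 < e / 2 by rewrite divr_gt0.
have : \forall t \near (0 : G), [set: X] `<=` [set x | mdist x (act t x) < e].
  move/compact_near_coveringP: hX; apply => x _.
  case: hact => act0 _ cact; have := cact (0, x).
  move=> /(_ _ (nbhsx_ballx (act 0 x) (e / 2) e2)) /=.
  rewrite act0 => -[[A B] /= [A0 Bx] AB].
  have xb : nbhs x (ball x (e / 2)) by exact: nbhsx_ballx.
  exists (B `&` ball x (e / 2), A) => /=; first by split=> //; exact: filterI.
  move=> [y t] /= [[By]]; rewrite ballEmdist /= => xy At.
  have := AB (t, y) (conj At By); rewrite /= ballEmdist /= => xty.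
  by rewrite (le_lt_trans (metric_triangle _ x _))// (metric_sym y) [ltRHS]splitr ltrD.
apply: filterS => t te; rewrite /almost_period /=.
rewrite (_ : [set x | _] = set0) ?measure0 ?lte_fin//.
by rewrite -subset0 => x /=; rewrite ltNge (ltW (te x I)).
Qed.

Hypothesis hperiods : forall eps : R, 0 < eps ->
  relatively_dense (almost_period act m (@mdist R X) eps).

Lemma regular_lipschitz u L C : 0 <= L ->
  (forall x y, `|u x - u y| <= L * mdist x y) -> (forall x, `|u x| <= C) ->
  regular_real u.
Proof.
move=> L0 uL uC; have su := square_integrable_lipschitz L0 uL uC.
have key (e : R) : 0 < e -> exists2 eps, 0 < eps &
    almost_period act m (@mdist R X) eps `<=` [set t | N (U t (realL2 su) - realL2 su) < e].
  move=> e0; pose B := L ^+ 2 + 4 * C ^+ 2 + 1.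
  have B0 : 0 < B by rewrite ltr_wpDl// addr_ge0 ?sqr_ge0// pmulr_rge0 ?sqr_ge0.
  exists (Num.min 1 (e / B / 2)); first by rewrite lt_min ltr01 !divr_gt0.
  set eps := Num.min _ _.
  have eps0 : 0 < eps by rewrite lt_min ltr01 !divr_gt0.
  have eps1 : eps <= 1 by rewrite ge_min lexx.
  have epsB : eps <= e / B / 2 by rewrite ge_min lexx orbT.
  move=> t tA /=.
  have -> : U t (realL2 su) = realL2 (square_integrable_act hact hm t su).
    exact/val_inj.
  rewrite realL2_sqnormB.
  rewrite (le_lt_trans (almost_period_return L0 uL uC eps0 tA))//.
  have : L ^+ 2 * eps ^+ 2 <= L ^+ 2 * eps.
    by rewrite ler_wpM2l ?sqr_ge0// expr2 ler_piMl// ltW.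
  have : B * eps <= e / 2.
    have -> : e / 2 = B * (e / B / 2) by field; rewrite gt_eqF.
    by rewrite ler_wpM2l// ltW.
  rewrite /B; lra.
exists su; apply: (regular_orbit_of_returns ipP UP).
  move=> e /key[eps eps0 sub]; apply: filterS (near_almost_period eps0).
  exact: sub.
move=> e /key[eps eps0 sub]; have [K cK AK] := hperiods eps0.
exists K => //; apply/seteqP; split=> [//|s _].
have : [set: G] s by [].
by rewrite -AK => -[a /sub ax [k Kk <-]]; exists a => //; exists k.
Qed.

Lemma regular_cst c : regular_real (fun=> c).
Proof.
apply: (@regular_lipschitz _ 0 `|c|) => // x y.
by rewrite subrr normr0 mul0r.
Qed.

(** The functions [min 1 (n * dist(x, ~` W))] are Lipschitz and increase to
    the indicator function of the open set [W]. *)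
Lemma regular_open (W : set X) : open W -> regular_real \1_W.
Proof.
move=> oW; have mW := open_borel oW.
have sW : square_integrable m (\1_W : borel X -> R).
  apply: (@square_integrable_bounded _ _ _ _ _ 1) => [|x].
    exact: measurable_indic.
  by rewrite indicE; case: (_ \in _); rewrite ?normr1 ?normr0.
have [W0|/set0P[y0 Wy0]] := eqVneq (~` W) set0.
  apply: eq_regular_real (regular_cst 1) => x.
  by rewrite indicE -[W]setCK W0 setC0 in_setT.
pose dist x := inf [set mdist x y | y in ~` W].
have dist_lb x : has_lbound [set mdist x y | y in ~` W].
  by exists 0 => _ [y _ <-]; exact: mdist_ge0.
have dist_le x y : (~` W) y -> dist x <= mdist x y.
  by move=> Wy; apply: ge_inf => //; exists y.
have le_dist x c : (forall y, (~` W) y -> c <= mdist x y) -> c <= dist x.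
  move=> h; apply: lb_le_inf; first by exists (mdist x y0), y0.
  by move=> _ [y Wy <-]; exact: h.
have dist0 x : 0 <= dist x by apply: le_dist => y _; exact: mdist_ge0.
have distL x y : dist x <= dist y + mdist x y.
  rewrite -lerBlDr; apply: le_dist => z Wz; rewrite lerBlDr.
  by rewrite (le_trans (dist_le x z Wz))// addrC metric_triangle.
pose u_ n x := Num.min 1 (n%:R * dist x).
have u1 n x : `|u_ n x| <= 1.
  by rewrite ger0_norm ?ge_min ?lexx// le_min ler01 mulr_ge0.
have uL n x y : `|u_ n x - u_ n y| <= n%:R * mdist x y.
  have h x' y' : u_ n x' - u_ n y' <= n%:R * mdist x' y'.
    have a1 : u_ n x' <= 1 by rewrite ge_min lexx.
    have a2 : u_ n x' <= n%:R * dist x' by rewrite ge_min lexx orbT.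
    rewrite lerBlDr [u_ n y']minEle.
    have : n%:R * dist x' <= n%:R * dist y' + n%:R * mdist x' y'.
      by rewrite -mulrDr ler_wpM2l.
    have : 0 <= n%:R * mdist x' y' by rewrite mulr_ge0 ?mdist_ge0.
    case: ifP => _; lra.
  by rewrite ler_norml lerNl opprB h andbT metric_sym h.
have ru n : regular_real (u_ n) by apply: (@regular_lipschitz _ n%:R 1).
have cu x : u_ ^~ x @ \oo --> (\1_W x : R).
  rewrite indicE; have [/set_mem Wx|] := boolP (x \in W); last first.
    rewrite notin_setE => Wx; have dx : dist x = 0.
      by apply/eqP; rewrite eq_le dist0 andbT -(mdistxx x) dist_le.
    rewrite (_ : u_ ^~ x = fun=> 0); first exact: cvg_cst.
    by apply/funext => n; rewrite /u_ dx mulr0 minEle leNgt ltr01.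
  have dx : 0 < dist x.
    have /nbhs_ballP[r /= r0 rW] : nbhs x W by exact: open_nbhs_nbhs.
    apply: lt_le_trans r0 (le_dist _ _ _) => y Wy.
    rewrite leNgt; apply/negP => xy; apply: Wy; apply: rW.
    by rewrite ballEmdist.
  apply: cvg_near_cst; exists (Num.truncn (dist x)^-1).+1 => // n /= n0.
  rewrite /u_ minEle -ler_pdivrMr// div1r (le_trans (ltW (truncnS_gt _)))//.
  by rewrite ler_nat.
apply: regular_real_limit => // e e0.
have mu_ n : measurable_fun [set: borel X] (u_ n : borel X -> R) by case: (ru n) => -[].
have h1 n (x : borel X) : ((\1_W x : R) - u_ n x) ^+ 2 <= 1.
  have := u1 n x; have : 0 <= u_ n x by rewrite le_min ler01 mulr_ge0.
  rewrite indicE ler_norml => ? /andP[? ?].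
  rewrite -(real_normK (num_real _)) expr_le1// ler_norml.
  by case: (_ \in _) => /=; apply/andP; split; lra.
have [n hn] := square_integrable_dominated_convergence mu_ sW.1 cu h1
  (finite_measure_integrable_cst m 1 measurableT) e0.
by exists (u_ n).
Qed.

(** The sets with a regular indicator form a lambda-system that contains the
    open sets, which are stable under intersection. *)
Lemma regular_indic (S : set (borel X)) : measurable S -> regular_real \1_S.
Proof.
pose H := [set A : set (borel X) | measurable A /\ regular_real \1_A].
suff : <<s [set: borel X], (@open X) >> `<=` H by move=> h /h[].
have setD_indic (A B : set (borel X)) x : B `<=` A ->
    \1_(A `\` B) x = 1 * \1_A x + -1 * \1_B x :> R.
  move=> BA; rewrite !indicE in_setD; have [xB|xB] := boolP (x \in B).
    have /mem_set -> : A x by exact/BA/set_mem.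
    by rewrite andbF mul1r mulN1r subrr.
  by rewrite andbT mulr0 addr0 mul1r.
apply: lambda_system_subset => //.
- by move=> A B oA oB; exact: openI.
- split=> //.
  + split=> //; apply: eq_regular_real (regular_cst 1) => x.
    by rewrite indicE in_setT.
  + move=> A B BA [mA rA] [mB rB]; split; first exact: measurableD.
    apply: eq_regular_real (regular_real_lincomb 1 (-1) rA rB) => x.
    by rewrite -setD_indic.
  + move=> F ndF HF; have mF i : measurable (F i) by case: (HF i).
    have mU : measurable (\bigcup_i F i) by exact: bigcup_measurable.
    split=> //; apply: regular_real_limit.
      apply: (@square_integrable_bounded _ _ _ _ _ 1) => [|x].
        exact: measurable_indic.
      by rewrite indicE; case: (_ \in _); rewrite ?normr1 ?normr0.
    move=> e e0.
    have mi n : measurable_fun [set: borel X] (\1_(F n) : borel X -> R).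
      exact: measurable_indic.
    have mi' : measurable_fun [set: borel X] (\1_(\bigcup_i F i) : borel X -> R).
      exact: measurable_indic.
    have c (x : borel X) : (fun n => \1_(F n) x : R) @ \oo --> (\1_(\bigcup_i F i) x : R).
      rewrite [X in _ --> X]indicE; have [/set_mem[k _ Fkx]|] := boolP (x \in \bigcup_i F i).
        apply: cvg_near_cst; exists k => // n /= kn.
        by rewrite indicE mem_set//; move: x Fkx; apply/subsetPset/ndF.
      rewrite notin_setE => nF; rewrite (_ : (fun n => _) = fun=> 0).
        exact: cvg_cst.
      apply/funext => n; rewrite indicE; case: (boolP (x \in F n)) => // /set_mem xF.
      by exfalso; apply: nF; exists n.
    have h1 n (x : borel X) : ((\1_(\bigcup_i F i) x : R) - \1_(F n) x) ^+ 2 <= 1.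
      rewrite !indicE; case: (_ \in _); case: (_ \in _) => /=;
        by rewrite ?subrr ?subr0 ?sub0r ?sqrrN ?expr0n ?expr1n ?ler01.
    have [n hn] := square_integrable_dominated_convergence mi mi' c h1
      (finite_measure_integrable_cst m 1 measurableT) e0.
    by exists \1_(F n) => //; case: (HF n).
- by move=> O oO; split; [exact: open_borel|exact: regular_open].
Qed.

Lemma regular_sum (I : Type) (r : seq I) (F : I -> borel X -> R) :
  (forall i, regular_real (F i)) -> regular_real (fun x => \sum_(i <- r) F i x).
Proof.
move=> rF; elim: r => [|i r IH].
  by apply: eq_regular_real (regular_cst 0) => x; rewrite big_nil.
apply: eq_regular_real (regular_real_lincomb 1 1 (rF i) IH) => x.
by rewrite big_cons !mul1r.
Qed.

Import HBNNSimple.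

Lemma regular_simple (h : {nnsfun borel X >-> R}) : regular_real h.
Proof.
have r1 (y : R) : regular_real (fun x => y * \1_(h @^-1` [set y]) x).
  have ri := regular_indic (measurable_sfunP h (measurable_set1 y)).
  apply: eq_regular_real (regular_real_lincomb y 0 ri ri) => x.
  by rewrite mul0r addr0.
apply: (@eq_regular_real (fun x => \sum_(y <- finmap.enum_fset (fset_set (range h)))
  y * \1_(h @^-1` [set y]) x)); last exact: regular_sum.
by move=> x; rewrite fimfunE fsbig_finite.
Qed.

(** Dominated convergence of an increasing sequence of simple functions *)
Lemma regular_ge0 u : square_integrable m u -> (forall x, 0 <= u x) ->
  regular_real u.
Proof.
move=> su u0; apply: regular_real_limit => // e e0.
have mu : measurable_fun [set: borel X] (EFin \o u).
  by apply/measurable_EFinP; case: su.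
pose g := nnsfun_approx measurableT mu.
have cg x : (fun n => g n x) @ \oo --> u x.
  have := cvg_nnsfun_approx measurableT mu (fun x _ => u0 x) (x := x) I.
  by move=> /fine_cvgP[].
have gu n x : g n x <= u x.
  rewrite -(cvg_lim _ (cg x))//; apply: nondecreasing_cvgn_le; last exact: cvgP (cg x).
  by move=> i j ij; have /lefP := nd_nnsfun_approx measurableT mu ij; apply.
have h1 n (x : borel X) : (u x - g n x) ^+ 2 <= u x ^+ 2.
  rewrite ler_pXn2r ?nnegrE ?subr_ge0 ?u0// lerBlDr lerDl.
  by rewrite fun_ge0.
have mg n : measurable_fun [set: borel X] (g n : borel X -> R) by [].
have [n hn] := square_integrable_dominated_convergence mg su.1 cg h1 su.2 e0.
by exists (g n) => //; exact: regular_simple.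
Qed.

Lemma regular_square_integrable u : square_integrable m u -> regular_real u.
Proof.
move=> [mu iu].
have mmax (v : borel X -> R) : measurable_fun [set: borel X] v ->
    (forall x, v x ^+ 2 = u x ^+ 2) -> regular_real (fun x => Num.max (v x) 0).
  move=> mv vu; apply: regular_ge0 => [|x]; last by rewrite le_max lexx orbT.
  have mv0 : measurable_fun [set: borel X] (fun x => Num.max (v x) 0).
    exact: measurable_maxr.
  split=> //; apply: le_integrable_real iu; first exact: measurable_funX.
  move=> x; rewrite ger0_norm ?sqr_ge0// -vu maxEle; case: ifP => // _.
  by rewrite expr0n sqr_ge0.
have r1 := mmax u mu (fun=> erefl).
have r2 : regular_real (fun x => Num.max (- u x) 0).
  by apply: mmax => [|x]; [exact: measurableT_comp|rewrite sqrrN].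
apply: eq_regular_real (regular_real_lincomb 1 (-1) r1 r2) => x.
rewrite !maxEle oppr_le0; case: (leP (u x) 0) => ux; case: (leP 0 (u x)) => ux'; lra.
Qed.

(** Every vector is almost periodic, since the almost periodic ones form a
    closed subspace that contains the Lipschitz functions. *)
Lemma regular_L2 (f : L2 m) : regular_orbit ip U f.
Proof.
have /in_L2P[sR sI] := L2_in f.
have [sR' rR] := regular_square_integrable sR.
have [sI' rI] := regular_square_integrable sI.
have -> : f = realL2 sR' + (0 +i* 1) *: realL2 sI'.
  apply/val_inj/funext => x; rewrite [RHS]L2_addE L2_scaleE /=.
  case: (L2_fun f x) => a b /=; apply/eqP; rewrite eq_complex /=.
  by apply/andP; split; apply/eqP; ring.
by apply: (regular_orbitD ipP UP) => //; exact: (regular_orbitZ ipP UP).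
Qed.

End RegularFunctions.

(** * Discrete spectrum from almost periodicity *)

Lemma L2_null d (T : measurableType d) (R : realType) (P : probability T R)
    (f : L2 P) :
  sqnorm (@L2ip _ _ _ P) f = 0 <-> {ae P, forall x, f x = 0}.
Proof.
have /in_L2P[[mR iR] [mI iI]] := L2_in f.
pose h x := complex.Re (f x) ^+ 2 + complex.Im (f x) ^+ 2.
have ih : P.-integrable [set: T] (EFin \o h) := integrable_realD iR iI.
have hE : (sqnorm (@L2ip _ _ _ P) f)%:E = (\int[P]_x `|(h x)%:E|)%E.
  rewrite L2_sqnormE -(RintegralD measurableT iR iI).
  rewrite /Rintegral fineK; last exact: integrable_fin_num ih.
  by apply: eq_integral => x _; rewrite /= ger0_norm// addr_ge0 ?sqr_ge0.
have aeE : (\int[P]_x `|(h x)%:E| = 0)%E <-> {ae P, forall x, f x = 0}.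
  rewrite (ae_eq_integral_abs P measurableT (measurable_int P ih)).
  split; apply: filterS => x.
    by move=> /(_ I) [hx]; exact: (@normc2_eq0 _ (f x) hx).
  by move=> fx _; rewrite /= /h fx /= expr0n addr0.
rewrite -aeE -hE; split=> [->//|]; by case.
Qed.

Lemma near_subr (G : topologicalZmodType) (t : G) (A : set G) :
  nbhs (0 : G) A -> \forall s \near t, A (t - s).
Proof.
have c : (t - s) @[s --> t] --> (0 : G).
  rewrite -(subrr t); have := @sub_continuous G (t, t).
  apply: (@cvg_comp _ _ _ (fun y => (t, y)) (fun p : G * G => p.1 - p.2)).
  by apply: cvg_pair => /=; [exact: cvg_cst|exact: cvg_id].
exact: c.
Qed.

Section DiscreteSpectrum.
Context (R : realType) (G : topologicalZmodType) (X : pmetricType R).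
Context (act : G -> X -> X) (m : probability (borel X) R).
Hypotheses (hact : continuous_action act) (hm : invariant_measure act m).
Local Notation ip := (@L2ip _ _ _ m).
Local Notation U := (koopmanL2 hact hm).
Local Notation N := (sqnorm ip).
Let ipP : semi_inner_product ip := L2ip_semi_inner_product m.
Let UP : isometric_representation ip U := koopman_representation hact hm.

Lemma normr_normc2 (z : R[i]) : normc2 z = 1 -> `|z| = 1.
Proof.
case: z => a b; rewrite /normc2 /= => ab1.
by rewrite normc_def /= ab1 sqrtr1.
Qed.

(** The eigenvalue at [t] is the matrix coefficient [<U t g, g>], which makes
    it a continuous character. *)
Lemma eigenvector_eigenfunction (g : L2 m) : ip g g = 1 ->
  common_eigen ip U g -> continuous_orbit ip U g ->
  exists2 gamma, dual_group G R gamma & eigenfunction act m gamma g.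
Proof.
move=> g1 gU gc; pose gamma t := ip (U t g) g.
have Ng : N g = 1 by rewrite /sqnorm g1.
have gz t : N (U t g - gamma t *: g) = 0.
  by have [z zt] := gU t; rewrite /gamma (ip_eigenvector ipP _ zt) g1 mulr1.
have gM s t : gamma (s + t) = gamma s * gamma t.
  have h : N (U s (U t g) - gamma t *: U s g) = 0.
    by rewrite -(repZ UP) -(repB UP) (rep_sqnorm UP) gz.
  by rewrite {1}/gamma (repM UP) (ip_eigenvector ipP _ h) mulrC.
have gn t : normc2 (gamma t) = 1.
  have := sqnormD_null ipP (gamma t *: g) (gz t).
  rewrite addrC subrK (rep_sqnorm UP) (sqnormZ ipP) Ng mulr1 => <-.
  by [].
have gN1 t : normc2 (gamma t - 1) = N (U t g - g).
  have := sqnormD_null ipP ((gamma t - 1) *: g) (gz t).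
  rewrite (sqnormZ ipP) Ng mulr1 => <-; congr N.
  by rewrite scalerBl scale1r addrC addrA subrK.
have [act0 _ _] := hact.
exists gamma.
  split => //; last by move=> t; exact: normr_normc2.
  move=> t; apply/cvgrPdist_lt => e e0.
  have [r r0 ->] : exists2 r : R, 0 < r & e = r%:C.
    case: e e0 => a b; rewrite ltcE /= => /andP[/eqP b0 a0].
    by exists a; rewrite ?b0.
  apply: filterS (near_subr t (gc _ (exprn_gt0 2 r0))) => s /=.
  rewrite -gN1 => h; have -> : gamma t - gamma s = (gamma (t - s) - 1) * gamma s.
    by rewrite mulrBl mul1r -gM subrK.
  move: h; rewrite -[X in X < _]mulr1 -(gn s) -normc2M.
  move: (_ * gamma s) => [a b]; rewrite /normc2 normc_def /= ltcR => h.
  by rewrite -(ltr_pXn2r (n := 2))// ?nnegrE ?sqrtr_ge0 ?(ltW r0)// sqr_sqrtr// addr_ge0 ?sqr_ge0.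
split.
- exact: L2_in.
- by move=> /L2_null; rewrite Ng => /eqP; rewrite oner_eq0.
- move=> t; have /L2_null := gz t; apply: filterS => x.
  by rewrite L2_subE L2_scaleE => /eqP; rewrite subr_eq0 => /eqP.
Qed.

Lemma L2_sum_seq (r : seq (R[i] * L2 m)) x :
  (\sum_(p <- r) p.1 *: p.2 : L2 m) x = \sum_(p <- r) p.1 * p.2 x.
Proof.
elim: r => [|p r IH]; first by rewrite !big_nil.
by rewrite !big_cons L2_addE IH.
Qed.

Lemma discrete_spectrum_of_regular :
  (forall f, regular_orbit ip U f) -> discrete_spectrum act m.
Proof.
move=> reg; have [|S [S1 SU So] dense] :=
  @eigenvector_basis _ _ _ ipP (@L2_complete _ _ _ m) _ _ UP.
  by move=> f; case: (reg f).
exists [set L2_fun f | f in S]; last first.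
  move=> _ [g Sg <-]; apply: eigenvector_eigenfunction; [exact: S1|exact: SU|].
  by case: (reg g).
split.
- by move=> _ [g _ <-]; exact: L2_in.
- by move=> _ [g /S1 g1 <-].
- move=> _ _ [f Sf <-] [g Sg <-] fg; apply: (So f g Sf Sg) => fgE.
  by apply: fg; rewrite fgE.
- move=> f Lf e e0; have [r rS fr] := dense (L2_of Lf) _ (exprn_gt0 2 e0).
  exists (size r), (fun i => L2_fun (tnth (in_tuple r) i).2),
    (fun i => (tnth (in_tuple r) i).1); split.
    by move=> i; exists (tnth (in_tuple r) i).2 => //; apply: rS; exact: mem_tnth.
  move/(L2norm_lt _ e0): fr; congr (L2norm m _ < _)%E; apply/funext => x.
  by rewrite L2_subE L2_sum_seq big_tnth.
Qed.

End DiscreteSpectrum.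

(** * Almost periods from discrete spectrum *)

Lemma compact_net (R : realType) (X : pmetricType R) (r : R) :
  compact [set: X] -> 0 < r ->
  exists xs : seq X, forall y, exists2 x, x \in xs & mdist x y < r.
Proof.
rewrite compact_cover => cX r0.
have [||D _ XD] := cX X setT (fun x => (ball x r)^°).
- by move=> x _; exact: open_interior.
- by move=> x _; exists x => //; exact: nbhsx_ballx.
exists (finmap.enum_fset D) => y; have [x xD /interior_subset] := XD y I.
by rewrite ballEmdist => xy; exists x.
Qed.

Lemma Rintegral_sum_le d (T : measurableType d) (R : realType)
    (P : probability T R) (I : eqType) (r : seq I) (F : I -> T -> R) (e : R) :
  (forall i, P.-integrable [set: T] (EFin \o F i)) ->
  (forall i, i \in r -> \int[P]_x F i x <= e) ->
  P.-integrable [set: T] (EFin \o (fun x => \sum_(i <- r) F i x)) /\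
  \int[P]_x (\sum_(i <- r) F i x) <= (size r)%:R * e.
Proof.
move=> iF; elim: r => [|i r IH] Fe.
  have -> : (fun x => \sum_(i <- [::]) F i x) = cst 0.
    by apply/funext => x; rewrite big_nil.
  by rewrite Rintegral_cst// !mul0r; split=> //; exact: finite_measure_integrable_cst.
have [|ir re] := IH; first by move=> j jr; apply: Fe; rewrite inE jr orbT.
have -> : (fun x => \sum_(j <- i :: r) F j x) =
    (fun x => F i x + \sum_(j <- r) F j x).
  by apply/funext => x; rewrite big_cons.
split; first exact: integrable_realD.
rewrite (RintegralD measurableT (iF i) ir) -natr1 mulrDl mul1r addrC lerD//.
by apply: Fe; rewrite mem_head.
Qed.

Section AlmostPeriods.
Context (R : realType) (G : topologicalZmodType) (X : pmetricType R).
Context (act : G -> X -> X) (m : probability (borel X) R).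
Hypotheses (hact : continuous_action act) (hm : invariant_measure act m).
Hypothesis hX : compact [set: X].
Local Notation ip := (@L2ip _ _ _ m).
Local Notation U := (koopmanL2 hact hm).
Local Notation N := (sqnorm ip).
Let ipP : semi_inner_product ip := L2ip_semi_inner_product m.
Let UP : isometric_representation ip U := koopman_representation hact hm.

Lemma eigenfunction_totally_bounded gamma (b : L2 m) :
  dual_group G R gamma -> eigenfunction act m gamma b ->
  totally_bounded_orbit ip U b.
Proof.
move=> [_ _ g1] [_ _ bU].
apply: (totally_bounded_orbit_eigenvector ipP (g := gamma)) => t.
  have := g1 t; rewrite normc_def /normc2; case: (gamma t) => x y /= [h].
  by rewrite -[LHS]sqr_sqrtr ?h ?expr1n// addr_ge0 ?sqr_ge0.
have bUt : {ae m, forall x : borel X, L2_fun (U t b) x = gamma t * b x} := bU t.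
apply/L2_null; apply: filterS bUt => x bx.
by rewrite L2_subE L2_scaleE [X in X - _]bx subrr.
Qed.

(** Finite combinations of eigenfunctions have totally bounded orbits, and
    they are dense. *)
Lemma discrete_spectrum_totally_bounded (f : L2 m) :
  discrete_spectrum act m -> totally_bounded_orbit ip U f.
Proof.
move=> [B [BL _ _ Bdense] Beig].
apply: (totally_bounded_orbit_limit ipP UP) => e e0.
have r0 : 0 < Num.sqrt e by rewrite sqrtr_gt0.
have [n [b [c [Bb fb]]]] := Bdense f (L2_in f) _ r0.
pose s : L2 m := \sum_(i < n) c i *: L2_of (BL _ (Bb i)).
exists s.
  rewrite /s; elim/big_ind: _ => [||i _].
  - move=> e' e'0; exists unit, (fun=> tt) => u v _.
    by rewrite -(scale0r (0 : L2 m)) !(repZ UP) !scale0r subrr (sqnorm0 ipP).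
  - by move=> x y; exact: (totally_bounded_orbitD ipP UP).
  - apply: (totally_bounded_orbitZ ipP UP).
    have [gamma gG bG] := Beig _ (Bb i).
    exact: (@eigenfunction_totally_bounded gamma (L2_of (BL _ (Bb i))) gG bG).
rewrite -[e]sqr_sqrtr ?(ltW e0)//; apply/(L2norm_lt _ r0).
move: fb; congr (L2norm m _ < _)%E; apply/funext => x.
rewrite L2_subE; congr (_ - _); rewrite /s.
have -> : L2_fun (\sum_(i < n) c i *: L2_of (BL _ (Bb i)) : L2 m) =
    \sum_(i < n) L2_fun (c i *: L2_of (BL _ (Bb i)) : L2 m).
  by apply: (big_morph (@L2_fun _ _ _ m)).
by rewrite fct_sumE.
Qed.

Lemma mdist_bounded (x : X) : exists C, forall y, `|mdist x y| <= C.
Proof.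
have [xs hxs] := compact_net hX ltr01.
exists (\sum_(z <- xs) mdist x z + 1) => y.
rewrite ger0_norm ?mdist_ge0//; have [z zxs zy] := hxs y.
rewrite (le_trans (metric_triangle x z y))// lerD//; last exact: ltW.
elim: (xs) zxs => [//|w ws IH]; rewrite inE big_cons => /predU1P[->|/IH zw].
  by rewrite lerDl sumr_ge0// => *; exact: mdist_ge0.
by rewrite (le_trans zw)// lerDr mdist_ge0.
Qed.

Lemma square_integrable_mdist (x : X) :
  square_integrable m (mdist x : borel X -> R).
Proof.
have [C hC] := mdist_bounded x.
apply: (square_integrable_lipschitz m (L := 1) (C := C)) => // y z.
by rewrite mul1r mdist_lipschitz.
Qed.

(** If the distances to the points of an [eps / 4]-net change little in the
    mean square under [t], then so does every point for most [x]: a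
    displacement of [x] by more than [eps] changes its distance to a close
    point of the net by more than [eps / 2]. *)
Lemma almost_periods_of_totally_bounded (eps : R) :
  (forall f, totally_bounded_orbit ip U f) -> 0 < eps ->
  relatively_dense (almost_period act m (@mdist R X) eps).
Proof.
move=> tb eps0; have [xs hxs] := compact_net hX (divr_gt0 eps0 (ltr0n R 4)).
pose n := (size xs)%:R + 1 : R.
have n0 : 0 < n by rewrite ltr_wpDl.
(* makes [size xs * e] smaller than [eps ^+ 2 / 4 * eps] *)
pose e := eps ^+ 3 / (4 * n).
have e0 : 0 < e by rewrite divr_gt0 ?exprn_gt0// mulr_gt0.
pose D x := realL2 (square_integrable_mdist x).
have [I [r hr]] := @totally_bounded_orbit_returns _ _ _ _ _ UP
  [seq D x | x <- xs] e e0 (fun f _ => tb f).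
exists [set r i | i in [set: I]].
  apply/finite_compact/finite_seqP; exists [seq r i | i <- enum I].
  apply/seteqP; split=> [_ [i _ <-] /=|_ /mapP[i _ ->]]; last by exists i.
  by apply: map_f; rewrite mem_enum.
apply/seteqP; split=> [//|s _]; have [i si] := hr s.
exists (s - r i); last by exists (r i); [exists i|rewrite subrK].
move: (s - r i) si => t tD; rewrite /almost_period /=.
pose A : set (borel X) := [set x | eps < mdist x (act t x)].
have mA : measurable A by apply: open_borel; exact: open_displacement hact _ _.
pose F x y := (mdist x (act t y) - mdist x y) ^+ 2.
have iF x : m.-integrable [set: borel X] (EFin \o F x).
  have sx := square_integrable_mdist x.
  by case: (square_integrableB (square_integrable_act hact hm t sx) sx).
have [iS Se] : m.-integrable [set: borel X] (EFin \o (fun y => \sum_(x <- xs) F x y)) /\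
    \int[m]_y (\sum_(x <- xs) F x y) <= (size xs)%:R * e.
  apply: (Rintegral_sum_le iF) => x xxs.
  have := tD (D x) (map_f _ xxs).
  have -> : U t (D x) = realL2 (square_integrable_act hact hm t (square_integrable_mdist x)).
    exact/val_inj.
  by rewrite realL2_sqnormB => /ltW.
have iA : m.-integrable [set: borel X] (EFin \o (\1_A : borel X -> R)).
  apply: (@integrable_bounded _ _ _ _ _ 1) => [|x]; first exact: measurable_indic.
  by rewrite indicE; case: (_ \in _); rewrite ?normr1 ?normr0.
have F0 x y : 0 <= F x y by exact: sqr_ge0.
have : eps ^+ 2 / 4 * fine (m A) <= (size xs)%:R * e.
  apply: le_trans Se.
  have -> : fine (m A) = \int[m]_x (\1_A x : R).
    rewrite /Rintegral; congr fine.
    by have := integral_indic m measurableT mA; rewrite setIT.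
  rewrite -(RintegralZl _ measurableT iA); apply: le_Rintegral => //.
    exact: integrable_realZ.
  move=> y _; rewrite indicE; have [/set_mem Ay|_] := boolP (y \in A); last first.
    by rewrite mulr0 sumr_ge0.
  rewrite mulr1; have [x xxs xy] := hxs y.
  apply: (@le_trans _ _ (F x y)); last first.
    elim: (xs) xxs => [//|w ws IH]; rewrite inE big_cons => /predU1P[->|/IH xw].
      by rewrite lerDl sumr_ge0.
    by rewrite (le_trans xw)// lerDr.
  rewrite /F (_ : eps ^+ 2 / 4 = (eps / 2) ^+ 2); last by field.
  have h : eps / 2 <= mdist x (act t y) - mdist x y.
    have := metric_triangle y x (act t y); rewrite (metric_sym y x).
    move: Ay; rewrite /A /=; lra.
  by rewrite ler_pXn2r ?nnegrE ?(le_trans _ h)// divr_ge0// ltW.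
move=> h; rewrite -[X in (X < _)%E]fineK; last first.
  by rewrite ge0_fin_numE// (le_lt_trans (probability_le1 _ mA))// ltry.
rewrite lte_fin -/A.
have q0 : 0 < eps ^+ 2 / 4 by rewrite divr_gt0// exprn_gt0.
rewrite -(ltr_pM2l q0) (le_lt_trans h)//.
have -> : eps ^+ 2 / 4 * eps = n * e by rewrite /e; field; rewrite gt_eqF.
by rewrite ltr_pM2r// ltrDl.
Qed.

End AlmostPeriods.

Theorem corollary4p3 (R : realType) (G : topologicalZmodType)
    (X : pmetricType R) (act : G -> X -> X) (m : probability (borel X) R)
    (hGlc : locally_compact [set: G]) (hGsc : sigma_compact G)
    (hX : compact [set: X])
    (hact : continuous_action act)
    (hm : invariant_measure act m) :
  (forall eps : R, 0 < eps ->
     relatively_dense (almost_period act m (@mdist R X) eps))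
  <-> discrete_spectrum act m.
Proof.
split=> [periods|ds eps eps0].
  apply: (discrete_spectrum_of_regular (hact := hact) (hm := hm)) => f.
  exact: regular_L2.
apply: (@almost_periods_of_totally_bounded _ _ _ _ _ hact hm hX _ _ eps0) => f.
exact: discrete_spectrum_totally_bounded.
Qed.
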